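(* Let $R$ be a ring and $M$ a $\tau_q$-projective $R$-module. Then the following statements hold. (1) $M\otimes_R\mathrm{T}(R[x])$ is a projective $\mathrm{T}(R[x])$-module. (2) $M_{\mathfrak p}$ is a free $R_{\mathfrak p}$-module for every non-semiregular prime ideal $\mathfrak p$ of $R$.
   Context: All rings are commutative with identity. $\mathrm{T}(R[x])$ is the total ring of quotients of the polynomial ring $R[x]$. An ideal $I$ of $R$ is dense if $(0:_R I)=\{r\in R: Ir=0\}=0$, and semi-regular if it contains a finitely generated dense ideal; an ideal is non-semiregular if it is not semi-regular. $\mathcal{Q}$ denotes the set of finitely generated semi-regular ideals of $R$. An $R$-module $N$ is $\mathcal Q$-torsion-free if $In=0$ with $I\in\mathcal Q$, $n\in N$ implies $n=0$. A $\mathcal Q$-torsion-free module $N$ is strongly Lucas if $\mathrm{Ext}^n_R(R/I,N)=0$ for every $I\in\mathcal Q$ and every $n\ge1$. An $R$-module $M$ is $\tau_q$-projective if $\mathrm{Ext}^1_R(M,N)=0$ for every strongly Lucas $R$-module $N$. *)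

(* Defs.v *)
From HB Require Import structures.
From mathcomp Require Import all_boot all_algebra.
From mathcomp Require Import boolp ring.

Set Implicit Arguments.
Unset Strict Implicit.
Unset Printing Implicit Defensive.

Import GRing.Theory.
Local Open Scope ring_scope.
Local Open Scope quotient_scope.

Record preZmod := PreZmod {
  pz_sort :> choiceType;
  pz_eq : pz_sort -> pz_sort -> Prop;
  pz_zero : pz_sort;
  pz_opp : pz_sort -> pz_sort;
  pz_add : pz_sort -> pz_sort -> pz_sort;
  pz_refl : forall x, pz_eq x x;
  pz_sym : forall x y, pz_eq x y -> pz_eq y x;
  pz_trans : forall x y z, pz_eq x y -> pz_eq y z -> pz_eq x z;
  pz_congrN : forall x x', pz_eq x x' -> pz_eq (pz_opp x) (pz_opp x');
  pz_congrD : forall x x' y y', pz_eq x x' -> pz_eq y y' ->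
    pz_eq (pz_add x y) (pz_add x' y');
  pz_addA : forall x y z, pz_eq (pz_add x (pz_add y z)) (pz_add (pz_add x y) z);
  pz_addC : forall x y, pz_eq (pz_add x y) (pz_add y x);
  pz_add0 : forall x, pz_eq (pz_add pz_zero x) x;
  pz_addN : forall x, pz_eq (pz_add (pz_opp x) x) pz_zero }.

Section QuotZmod.
Variable D : preZmod.

Definition pz_rel : rel D := fun x y => `[< pz_eq x y >].

Lemma pz_rel_equiv : equiv_class_of pz_rel.
Proof.
split=> [x|x y|y x z]; first exact/asboolP/pz_refl.
  by apply/asboolP/asboolP; apply: pz_sym.
by move=> /asboolP xy /asboolP yz; apply/asboolP; apply: pz_trans xy yz.
Qed.
Canonical pz_equiv_rel := EquivRelPack pz_rel_equiv.
Canonical pz_encModRel := defaultEncModRel pz_rel.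

Definition quotZ := {eq_quot pz_rel}.
HB.instance Definition _ := EqQuotient.on quotZ.
HB.instance Definition _ := Choice.on quotZ.

Definition qcls (x : D) : quotZ := \pi_quotZ x.
Definition qrep (q : quotZ) : D := repr q.

Lemma qrepK q : qcls (qrep q) = q. Proof. exact: reprK. Qed.
Lemma qcls_eq x y : qcls x = qcls y <-> pz_eq x y.
Proof.
split=> [/eqmodP/asboolP //|exy].
by apply/eqmodP/asboolP.
Qed.
Lemma qrep_cls x : pz_eq (qrep (qcls x)) x.
Proof. by apply/qcls_eq; rewrite qrepK. Qed.
Lemma quotZ_ind (P : quotZ -> Prop) : (forall x, P (qcls x)) -> forall q, P q.
Proof. by move=> Px q; rewrite -(qrepK q). Qed.

Definition quotZ_opp (p : quotZ) := qcls (pz_opp (qrep p)).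
Definition quotZ_add (p q : quotZ) := qcls (pz_add (qrep p) (qrep q)).

Lemma quotZ_oppE x : quotZ_opp (qcls x) = qcls (pz_opp x).
Proof. exact/qcls_eq/pz_congrN/qrep_cls. Qed.
Lemma quotZ_addE x y : quotZ_add (qcls x) (qcls y) = qcls (pz_add x y).
Proof. by apply/qcls_eq/pz_congrD; apply: qrep_cls. Qed.

Lemma quotZ_addA : associative quotZ_add.
Proof.
elim/quotZ_ind=> x; elim/quotZ_ind=> y; elim/quotZ_ind=> z.
by rewrite !quotZ_addE; apply/qcls_eq/pz_addA.
Qed.
Lemma quotZ_addC : commutative quotZ_add.
Proof.
elim/quotZ_ind=> x; elim/quotZ_ind=> y.
by rewrite !quotZ_addE; apply/qcls_eq/pz_addC.
Qed.
Lemma quotZ_add0 : left_id (qcls (pz_zero D)) quotZ_add.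
Proof. by elim/quotZ_ind=> x; rewrite quotZ_addE; apply/qcls_eq/pz_add0. Qed.
Lemma quotZ_addN : left_inverse (qcls (pz_zero D)) quotZ_opp quotZ_add.
Proof.
by elim/quotZ_ind=> x; rewrite quotZ_oppE quotZ_addE; apply/qcls_eq/pz_addN.
Qed.

HB.instance Definition _ :=
  GRing.isZmodule.Build quotZ quotZ_addA quotZ_addC quotZ_add0 quotZ_addN.

Lemma qcls0 : qcls (pz_zero D) = 0. Proof. by []. Qed.
Lemma qclsN x : qcls (pz_opp x) = - qcls x. Proof. by rewrite -quotZ_oppE. Qed.
Lemma qclsD x y : qcls (pz_add x y) = qcls x + qcls y.
Proof. by rewrite -quotZ_addE. Qed.
End QuotZmod.

Section QuotMod.
Variables (R : pzRingType) (V : lmodType R) (W : submodClosed V).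

Let Wopp x : (- x \in W) = (x \in W).
Proof.
by apply/idP/idP=> h; [rewrite -[x]opprK|]; rewrite -scaleN1r rpredZ.
Qed.

Definition quotmod_eq (x y : V) := x - y \in W.

Fact quotmod_refl x : quotmod_eq x x.
Proof. by rewrite /quotmod_eq subrr rpred0. Qed.
Fact quotmod_sym x y : quotmod_eq x y -> quotmod_eq y x.
Proof. by rewrite /quotmod_eq -opprB Wopp. Qed.
Fact quotmod_trans x y z : quotmod_eq x y -> quotmod_eq y z -> quotmod_eq x z.
Proof. by rewrite /quotmod_eq => xy yz; rewrite -(subrKA y) rpredD. Qed.
Fact quotmod_congrN x x' : quotmod_eq x x' -> quotmod_eq (- x) (- x').
Proof. by rewrite /quotmod_eq -opprD Wopp. Qed.
Fact quotmod_congrD x x' y y' : quotmod_eq x x' -> quotmod_eq y y' ->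
  quotmod_eq (x + y) (x' + y').
Proof. by rewrite /quotmod_eq => ? ?; rewrite opprD addrACA rpredD. Qed.

Fact quotmod_addA x y z : quotmod_eq (x + (y + z)) (x + y + z).
Proof. by rewrite addrA; apply: quotmod_refl. Qed.
Fact quotmod_addC x y : quotmod_eq (x + y) (y + x).
Proof. by rewrite addrC; apply: quotmod_refl. Qed.
Fact quotmod_add0 x : quotmod_eq (0 + x) x.
Proof. by rewrite add0r; apply: quotmod_refl. Qed.
Fact quotmod_addN x : quotmod_eq (- x + x) 0.
Proof. by rewrite addNr; apply: quotmod_refl. Qed.

Definition quotmod_pre := PreZmod quotmod_refl quotmod_sym quotmod_trans
  quotmod_congrN quotmod_congrD quotmod_addA quotmod_addC quotmod_add0
  quotmod_addN.

Definition quotmod : Type := quotZ quotmod_pre.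
HB.instance Definition _ := GRing.Zmodule.on quotmod.

Definition quotmod_pi (x : V) : quotmod := qcls (x : quotmod_pre).

Lemma quotmod_piP x y : quotmod_pi x = quotmod_pi y <-> x - y \in W.
Proof. exact: qcls_eq. Qed.

Definition quotmod_scale (a : R) (q : quotmod) : quotmod :=
  quotmod_pi (a *: (qrep q : V)).

Lemma quotmod_scaleE a x : quotmod_scale a (quotmod_pi x) = quotmod_pi (a *: x).
Proof.
apply/quotmod_piP; rewrite -scalerBr rpredZ //.
exact: (qrep_cls (x : quotmod_pre)).
Qed.

Lemma quotmod_piD x y : quotmod_pi (x + y) = quotmod_pi x + quotmod_pi y.
Proof. exact: (qclsD (x : quotmod_pre)). Qed.

Lemma quotmod_ind (P : quotmod -> Prop) :
  (forall x, P (quotmod_pi x)) -> forall q, P q.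
Proof. exact: (@quotZ_ind quotmod_pre P). Qed.

Fact quotmod_scalerA a b q :
  quotmod_scale a (quotmod_scale b q) = quotmod_scale (a * b) q.
Proof. by elim/quotmod_ind: q => x; rewrite !quotmod_scaleE scalerA. Qed.
Fact quotmod_scale1r : left_id 1 quotmod_scale.
Proof. by elim/quotmod_ind=> x; rewrite quotmod_scaleE scale1r. Qed.
Fact quotmod_scalerDr : right_distributive quotmod_scale +%R.
Proof.
move=> a; elim/quotmod_ind=> x; elim/quotmod_ind=> y.
by rewrite -quotmod_piD !quotmod_scaleE scalerDr quotmod_piD.
Qed.
Fact quotmod_scalerDl q : {morph quotmod_scale^~ q : a b / a + b}.
Proof.
elim/quotmod_ind: q => x a b.
by rewrite !quotmod_scaleE scalerDl quotmod_piD.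
Qed.

HB.instance Definition _ := GRing.Zmodule_isLmodule.Build R quotmod
  quotmod_scalerA quotmod_scale1r quotmod_scalerDr quotmod_scalerDl.
End QuotMod.

Section Localization.
Variables (A : comPzRingType) (S : mulrClosed A).
Local Notation denom := {s : A | s \in S}.

Definition denom1 : denom := exist _ 1 (rpred1 S).
Definition denomM (s t : denom) : denom :=
  exist _ (sval s * sval t) (rpredM (valP s) (valP t)).

Section Module.
Variable M : lmodType A.

Definition loc_eq (x y : M * denom) :=
  exists2 u, u \in S & u *: (sval y.2 *: x.1 - sval x.2 *: y.1) = 0.

Definition loc_zero : M * denom := (0, denom1).
Definition loc_opp (x : M * denom) : M * denom := (- x.1, x.2).
Definition loc_add (x y : M * denom) : M * denom :=
  (sval y.2 *: x.1 + sval x.2 *: y.1, denomM x.2 y.2).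

Let loc_eqE x y : loc_eq x y <->
  exists2 u, u \in S & (u * sval y.2) *: x.1 = (u * sval x.2) *: y.1.
Proof.
split=> -[u uS e]; exists u => //.
  by move/eqP: e; rewrite scalerBr !scalerA subr_eq0 => /eqP.
by rewrite scalerBr !scalerA e subrr.
Qed.

Fact loc_refl x : loc_eq x x.
Proof. by exists 1; rewrite ?rpred1 // subrr scaler0. Qed.
Fact loc_sym x y : loc_eq x y -> loc_eq y x.
Proof. by case/loc_eqE=> u uS e; apply/loc_eqE; exists u. Qed.
Fact loc_trans x y z : loc_eq x y -> loc_eq y z -> loc_eq x z.
Proof.
case/loc_eqE=> u uS e /loc_eqE[v vS f]; apply/loc_eqE.
exists (u * v * sval y.2); first by rewrite !rpredM // (valP y.2).
have -> : u * v * sval y.2 * sval z.2 = (v * sval z.2) * (u * sval y.2) by ring.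
rewrite -scalerA e scalerA.
have -> : v * sval z.2 * (u * sval x.2) = (u * sval x.2) * (v * sval z.2) by ring.
by rewrite -scalerA f scalerA; congr (_ *: _); ring.
Qed.
Fact loc_congrN x x' : loc_eq x x' -> loc_eq (loc_opp x) (loc_opp x').
Proof.
by case/loc_eqE=> u uS e; apply/loc_eqE; exists u; rewrite //= !scalerN e.
Qed.

Fact loc_addC x y : loc_eq (loc_add x y) (loc_add y x).
Proof.
apply/loc_eqE; exists 1; rewrite ?rpred1 //= addrC.
by rewrite [sval x.2 * _]mulrC.
Qed.
Fact loc_congrDl x x' y : loc_eq x x' -> loc_eq (loc_add x y) (loc_add x' y).
Proof.
case/loc_eqE=> u uS e; apply/loc_eqE; exists u => //=.
rewrite !scalerDr !scalerA; congr (_ + _); last by congr (_ *: _); ring.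
have -> : u * (sval x'.2 * sval y.2) * sval y.2
        = (sval y.2 * sval y.2) * (u * sval x'.2) by ring.
by rewrite -scalerA e scalerA; congr (_ *: _); ring.
Qed.
Fact loc_congrD x x' y y' : loc_eq x x' -> loc_eq y y' ->
  loc_eq (loc_add x y) (loc_add x' y').
Proof.
move=> /loc_congrDl xx /loc_congrDl yy; apply: loc_trans (xx y) _.
apply: loc_trans (loc_addC _ _) _; apply: loc_trans (yy x') _.
exact: loc_addC.
Qed.

Lemma loc_eq_of x y : x.1 = y.1 -> sval x.2 = sval y.2 -> loc_eq x y.
Proof. by move=> e f; apply/loc_eqE; exists 1; rewrite ?rpred1 // e f. Qed.

Fact loc_addA x y z :
  loc_eq (loc_add x (loc_add y z)) (loc_add (loc_add x y) z).
Proof.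
apply: loc_eq_of => /=; last by rewrite mulrA.
by rewrite !scalerDr !scalerA addrA; congr (_ *: _ + _ *: _ + _ *: _); ring.
Qed.
Fact loc_add0 x : loc_eq (loc_add loc_zero x) x.
Proof. by apply: loc_eq_of; rewrite /= ?mul1r // scaler0 add0r scale1r. Qed.
Fact loc_addN x : loc_eq (loc_add (loc_opp x) x) loc_zero.
Proof.
apply/loc_eqE; exists 1; rewrite ?rpred1 //=.
by rewrite scalerN addNr !scaler0.
Qed.

Definition loc_pre := PreZmod loc_refl loc_sym loc_trans
  loc_congrN loc_congrD loc_addA loc_addC loc_add0 loc_addN.

Definition locmod : Type := quotZ loc_pre.
HB.instance Definition _ := GRing.Zmodule.on locmod.

Definition mfrac (m : M) (s : denom) : locmod := qcls ((m, s) : loc_pre).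

Lemma fracP m s n t : mfrac m s = mfrac n t <->
  exists2 u, u \in S & u *: (sval t *: m - sval s *: n) = 0.
Proof. exact: (qcls_eq ((m, s) : loc_pre) (n, t)). Qed.

Lemma frac_eq m s n t : m = n -> sval s = sval t -> mfrac m s = mfrac n t.
Proof. by move=> e f; apply/qcls_eq/loc_eq_of. Qed.

Lemma fracM (u : denom) m s : mfrac (sval u *: m) (denomM u s) = mfrac m s.
Proof.
apply/fracP; exists 1; rewrite ?rpred1 //= scalerA.
by rewrite mulrC subrr scaler0.
Qed.

Lemma fracD m s n t :
  mfrac m s + mfrac n t = mfrac (sval t *: m + sval s *: n) (denomM s t).
Proof. by rewrite /mfrac -qclsD. Qed.

Lemma locmod_ind (P : locmod -> Prop) :
  (forall m s, P (mfrac m s)) -> forall q, P q.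
Proof. by move=> h; elim/quotZ_ind=> -[m s]; apply: h. Qed.
End Module.

(* S^-1 A, as an abelian group; its ring structure is the restriction of the
   action of S^-1 A on S^-1 M to M = A. *)
Definition locring : Type := locmod A^o.
HB.instance Definition _ := GRing.Zmodule.on locring.

Definition rfrac (a : A) (s : denom) : locring := @mfrac A^o a s.

Lemma locring_ind (P : locring -> Prop) :
  (forall a s, P (rfrac a s)) -> forall q, P q.
Proof. exact: (@locmod_ind A^o). Qed.

Lemma rfracD a s b t :
  rfrac a s + rfrac b t = rfrac (sval t * a + sval s * b) (denomM s t).
Proof. exact: fracD. Qed.

Section Scale.
Variable M : lmodType A.

Definition loc_scale (a : locring) (q : locmod M) : locmod M :=
  mfrac (((qrep a).1 : A) *: (qrep q).1) (denomM (qrep a).2 (qrep q).2).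

Lemma loc_scaleE a s m t :
  loc_scale (rfrac a s) (mfrac m t) = mfrac (a *: m) (denomM s t).
Proof.
rewrite /loc_scale.
have := qrep_cls ((a, s) : loc_pre A^o); have := qrep_cls ((m, t) : loc_pre M).
rewrite -/(mfrac m t) -/(rfrac a s).
case: (qrep (mfrac m t)) => m' t'; case: (qrep (rfrac a s)) => a' s' /=.
case=> u uS /= e [v vS] /= f; apply/fracP; exists (u * v).
  by rewrite rpredM.
move: e f; rewrite !scalerBr => /eqP; rewrite subr_eq0 => /eqP e /eqP.
rewrite subr_eq0 => /eqP f; apply/eqP; rewrite subr_eq0; apply/eqP.
have {}f : v * (sval s * a') = v * (sval s' * a) by [].
rewrite /= !scalerA.
have -> : u * v * (sval s * sval t * a') = (v * (sval s * a')) * (u * sval t).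
  by ring.
move: e; rewrite !scalerA => e; rewrite f -[_ *: m']scalerA.
rewrite [X in _ *: X](e : _ = (u * sval t') *: m) scalerA.
by congr (_ *: _); ring.
Qed.

Lemma loc_scaleDr : right_distributive loc_scale +%R.
Proof.
elim/locring_ind=> a s; elim/locmod_ind=> m t; elim/locmod_ind=> n w.
rewrite fracD !loc_scaleE fracD /=.
rewrite -(fracM s); apply: frac_eq => /=; last by ring.
by rewrite !scalerDr !scalerA; congr (_ *: _ + _ *: _); ring.
Qed.

Lemma loc_scaleDl q : {morph loc_scale^~ q : a b / a + b}.
Proof.
elim/locmod_ind: q => m t; elim/locring_ind=> a s; elim/locring_ind=> b w /=.
rewrite rfracD !loc_scaleE fracD /=.
rewrite -(fracM t); apply: frac_eq => /=; last by ring.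
by rewrite !scalerA -!scalerDl; congr (_ *: _); ring.
Qed.
End Scale.

Lemma loc_scaleA (M : lmodType A) a b (q : locmod M) :
  loc_scale a (loc_scale b q) = loc_scale (loc_scale a b : locring) q.
Proof.
elim/locmod_ind: q => m t; elim/locring_ind: a => a s.
elim/locring_ind: b => b w.
have -> : loc_scale (rfrac a s) (rfrac b w) = rfrac (a * b) (denomM s w).
  exact: loc_scaleE.
by rewrite !loc_scaleE scalerA; apply: frac_eq; rewrite //= mulrA.
Qed.

Lemma loc_scale1 (M : lmodType A) : left_id (rfrac 1 denom1) (@loc_scale M).
Proof.
elim/locmod_ind=> m t; rewrite loc_scaleE scale1r.
by apply: frac_eq; rewrite //= mul1r.
Qed.

Definition locring_mul (a b : locring) : locring := loc_scale a b.

Lemma rfracM a s b t :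
  locring_mul (rfrac a s) (rfrac b t) = rfrac (a * b) (denomM s t).
Proof. exact: loc_scaleE. Qed.

Fact locring_mulA : associative locring_mul.
Proof. by move=> a b c; rewrite /locring_mul loc_scaleA. Qed.
Fact locring_mulC : commutative locring_mul.
Proof.
elim/locring_ind=> a s; elim/locring_ind=> b t; rewrite !rfracM.
by apply: frac_eq; rewrite /= mulrC.
Qed.
Fact locring_mul1 : left_id (rfrac 1 denom1) locring_mul.
Proof. exact: loc_scale1. Qed.
Fact locring_mulDl : left_distributive locring_mul +%R.
Proof. by move=> a b c; apply: loc_scaleDl. Qed.

HB.instance Definition _ := GRing.Zmodule_isComPzRing.Build locring
  locring_mulA locring_mulC locring_mul1 locring_mulDl.

HB.instance Definition _ (M : lmodType A) :=
  GRing.Zmodule_isLmodule.Build locring (locmod M)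
    (@loc_scaleA M) (@loc_scale1 M) (@loc_scaleDr M) (@loc_scaleDl M).

Definition locring_in (a : A) : locring := rfrac a denom1.

Fact locring_in_zmod : zmod_morphism locring_in.
Proof.
move=> a b; apply/esym/eqP; rewrite subr_eq rfracD; apply/eqP.
by apply: frac_eq; rewrite /= !mul1r ?subrK.
Qed.
Fact locring_in_monoid : monoid_morphism locring_in.
Proof.
by split=> // a b; rewrite [RHS]rfracM; apply: frac_eq; rewrite //= mul1r.
Qed.
HB.instance Definition _ :=
  GRing.isZmodMorphism.Build A locring locring_in locring_in_zmod.
HB.instance Definition _ :=
  GRing.isMonoidMorphism.Build A locring locring_in locring_in_monoid.
End Localization.

Section RegularElements.
Variable A : comPzRingType.

Definition regular_elts : {pred A} := fun a => `[< GRing.lreg a >].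

Fact regular_elts_mulr_closed : GRing.mulr_closed regular_elts.
Proof.
split=> [|a b]; first by apply/asboolP; apply: GRing.lreg1.
by move=> /asboolP ra /asboolP rb; apply/asboolP; apply: GRing.lregM.
Qed.
HB.instance Definition _ :=
  GRing.isMulClosed.Build A regular_elts regular_elts_mulr_closed.

Definition total_quotient_ring : Type := locring regular_elts.
HB.instance Definition _ := GRing.ComPzRing.on total_quotient_ring.
End RegularElements.

Section AtPrime.
Variables (A : comNzRingType) (p : prime_idealr A).

Definition prime_compl : {pred A} := fun a => a \notin p.

Fact prime_compl_mulr_closed : GRing.mulr_closed prime_compl.
Proof.
have complE a : (a \in prime_compl) = (a \notin p) by [].
split=> [|a b]; rewrite !complE ?idealr1 // => ap bp.
by apply/negP; rewrite prime_idealrM => /orP[]; apply/negP.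
Qed.
HB.instance Definition _ :=
  GRing.isMulClosed.Build A prime_compl prime_compl_mulr_closed.

Definition ring_at_prime : Type := locring prime_compl.
HB.instance Definition _ := GRing.ComPzRing.on ring_at_prime.

Definition mod_at_prime (M : lmodType A) : Type := locmod prime_compl M.
HB.instance Definition _ (M : lmodType A) :=
  GRing.Zmodule.on (mod_at_prime M).
HB.instance Definition _ (M : lmodType A) :=
  GRing.Lmodule.copy (mod_at_prime M) (locmod prime_compl M).
End AtPrime.

(* M (x)_R T, as a T-module, for a ring morphism phi : R -> T. *)
Section Tensor.
Variables (R T : comPzRingType) (phi : {rmorphism R -> T}) (M : lmodType R).

(* Finite formal sums of pairs (m, t), modulo the congruence generated by
   commutativity of the sum and R-bilinearity. *)
Inductive tens_eq : seq (M * T) -> seq (M * T) -> Prop :=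
| tens_refl x : tens_eq x x
| tens_sym x y : tens_eq x y -> tens_eq y x
| tens_trans x y z : tens_eq x y -> tens_eq y z -> tens_eq x z
| tens_cat x x' y y' : tens_eq x x' -> tens_eq y y' ->
    tens_eq (x ++ y) (x' ++ y')
| tens_catC x y : tens_eq (x ++ y) (y ++ x)
| tens_0l t : tens_eq [:: (0, t)] [::]
| tens_Dl m n t : tens_eq [:: (m + n, t)] [:: (m, t); (n, t)]
| tens_Dr m t u : tens_eq [:: (m, t + u)] [:: (m, t); (m, u)]
| tens_bal r m t : tens_eq [:: (r *: m, t)] [:: (m, phi r * t)].

Definition tens_opp (x : seq (M * T)) := [seq (- mt.1, mt.2) | mt <- x].
Definition tens_scale (a : T) (x : seq (M * T)) :=
  [seq (mt.1, a * mt.2) | mt <- x].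

Fact tens_congrN x x' : tens_eq x x' -> tens_eq (tens_opp x) (tens_opp x').
Proof.
elim=> /=.
- by move=> *; apply: tens_refl.
- by move=> *; apply: tens_sym.
- by move=> ? y ? _ h _ k; apply: tens_trans h k.
- by move=> *; rewrite /tens_opp !map_cat; apply: tens_cat.
- by move=> *; rewrite /tens_opp !map_cat; apply: tens_catC.
- by move=> t; rewrite oppr0; apply: tens_0l.
- by move=> m n t; rewrite opprD; apply: tens_Dl.
- by move=> *; apply: tens_Dr.
- by move=> r m t; rewrite -scalerN; apply: tens_bal.
Qed.

Fact tens_addA x y z : tens_eq (x ++ (y ++ z)) ((x ++ y) ++ z).
Proof. by rewrite catA; apply: tens_refl. Qed.
Fact tens_add0 x : tens_eq ([::] ++ x) x.
Proof. exact: tens_refl. Qed.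
Fact tens_addN x : tens_eq (tens_opp x ++ x) [::].
Proof.
elim: x => [|[m t] x IH]; first exact: tens_refl.
rewrite -cat1s -/(tens_opp x) /tens_opp map_cat -/(tens_opp x) -catA.
apply: (@tens_trans _ ([:: (- m, t)] ++ (tens_opp x ++ x) ++ [:: (m, t)])).
  apply: tens_cat; first exact: tens_refl.
  by rewrite -catA; apply: tens_cat; [exact: tens_refl|exact: tens_catC].
apply: (@tens_trans _ ([:: (- m, t)] ++ [::] ++ [:: (m, t)])).
  apply: tens_cat; first exact: tens_refl.
  by apply: tens_cat; [|exact: tens_refl].
apply: (@tens_trans _ [:: (- m + m, t)]); first exact/tens_sym/tens_Dl.
by rewrite addNr; apply: tens_0l.
Qed.

Definition tens_pre := @PreZmod (seq (M * T)) tens_eq [::] tens_opp cat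
  tens_refl tens_sym tens_trans tens_congrN tens_cat tens_addA tens_catC
  tens_add0 tens_addN.

Definition tensor : Type := quotZ tens_pre.
HB.instance Definition _ := GRing.Zmodule.on tensor.

Definition tens_cls (x : seq (M * T)) : tensor := qcls (x : tens_pre).

Definition tens (m : M) (t : T) : tensor := tens_cls [:: (m, t)].

Lemma tens_clsP x y : tens_cls x = tens_cls y <-> tens_eq x y.
Proof. exact: (@qcls_eq tens_pre). Qed.
Lemma tens_clsD x y : tens_cls (x ++ y) = tens_cls x + tens_cls y.
Proof. exact: (@qclsD tens_pre). Qed.
Lemma tensor_ind (P : tensor -> Prop) :
  (forall x, P (tens_cls x)) -> forall q, P q.
Proof. exact: (@quotZ_ind tens_pre P). Qed.

Lemma tens_congrZ a x x' :
  tens_eq x x' -> tens_eq (tens_scale a x) (tens_scale a x').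
Proof.
elim=> /=.
- by move=> *; apply: tens_refl.
- by move=> *; apply: tens_sym.
- by move=> ? y ? _ h _ k; apply: tens_trans h k.
- by move=> *; rewrite /tens_scale !map_cat; apply: tens_cat.
- by move=> *; rewrite /tens_scale !map_cat; apply: tens_catC.
- by move=> t; apply: tens_0l.
- by move=> m n t; apply: tens_Dl.
- by move=> m t u; rewrite mulrDr; apply: tens_Dr.
- by move=> r m t; rewrite mulrCA; apply: tens_bal.
Qed.

(* The T-module structure: a . (m (x) t) = m (x) at. *)
Definition tensor_scale (a : T) (q : tensor) : tensor :=
  tens_cls (tens_scale a (qrep q)).

Lemma tensor_scaleE a x :
  tensor_scale a (tens_cls x) = tens_cls (tens_scale a x).
Proof. exact/tens_clsP/tens_congrZ/(@qrep_cls tens_pre). Qed.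

Fact tensor_scaleA a b q :
  tensor_scale a (tensor_scale b q) = tensor_scale (a * b) q.
Proof.
elim/tensor_ind: q => x; rewrite !tensor_scaleE; congr tens_cls.
by rewrite /tens_scale -map_comp; apply: eq_map => mt /=; rewrite mulrA.
Qed.
Fact tensor_scale1 : left_id 1 tensor_scale.
Proof.
elim/tensor_ind=> x; rewrite tensor_scaleE; congr tens_cls.
by rewrite -[RHS]map_id; apply: eq_map => -[m t] /=; rewrite mul1r.
Qed.
Fact tensor_scaleDr : right_distributive tensor_scale +%R.
Proof.
move=> a; elim/tensor_ind=> x; elim/tensor_ind=> y.
by rewrite -tens_clsD !tensor_scaleE -tens_clsD /tens_scale map_cat.
Qed.
Fact tensor_scaleDl q : {morph tensor_scale^~ q : a b / a + b}.
Proof.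
move=> a b; elim/tensor_ind: q => x; rewrite !tensor_scaleE.
elim: x => [|[m t] x IH].
  by rewrite -tens_clsD.
rewrite -[(m, t) :: x]cat1s /tens_scale !map_cat !tens_clsD [in LHS]IH.
rewrite addrACA; congr (_ + _); rewrite -tens_clsD; apply/tens_clsP => /=.
by rewrite mulrDl; apply: tens_Dr.
Qed.

HB.instance Definition _ := GRing.Zmodule_isLmodule.Build T tensor
  tensor_scaleA tensor_scale1 tensor_scaleDr tensor_scaleDl.
End Tensor.

Definition projective_module (R : pzRingType) (P : lmodType R) : Prop :=
  forall (A B : lmodType R) (g : {linear A -> B}) (f : {linear P -> B}),
    (forall b, exists a, g a = b) ->
  exists h : {linear P -> A}, forall x, g (h x) = f x.

Definition is_basis (R : pzRingType) (M : lmodType R) (B : M -> Prop) : Prop :=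
  (forall (s : seq M) (c : M -> R), uniq s -> (forall b, b \in s -> B b) ->
     \sum_(b <- s) c b *: b = 0 -> forall b, b \in s -> c b = 0)
  /\ (forall m, exists (s : seq M) (c : M -> R),
        (forall b, b \in s -> B b) /\ m = \sum_(b <- s) c b *: b).

Definition free_module (R : pzRingType) (M : lmodType R) : Prop :=
  exists B : M -> Prop, is_basis B.

Section Ext.
Variable R : pzRingType.

(* ... -> P_2 -> P_1 -> P_0 -> A -> 0, with res_d n : P_(n+1) -> P_n. *)
Record projective_resolution (A : lmodType R) := ProjectiveResolution {
  res_mod :> nat -> lmodType R;
  res_d : forall n, {linear res_mod n.+1 -> res_mod n};
  res_aug : {linear res_mod 0 -> A};
  res_projective : forall n, projective_module (res_mod n);
  res_aug_surj : forall a, exists x, res_aug x = a;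
  res_aug_exact : forall x, res_aug x = 0 <-> exists y, res_d 0 y = x;
  res_exact : forall n x, res_d n x = 0 <-> exists y, res_d n.+1 y = x }.

Variables (A : lmodType R) (P : projective_resolution A) (N : lmodType R).

Definition cocycle n (f : {linear P n -> N}) : Prop :=
  forall x, f (res_d P n x) = 0.

Definition coboundary n : {linear P n -> N} -> Prop :=
  match n with
  | 0 => fun f => forall x, f x = 0
  | k.+1 => fun f =>
      exists g : {linear P k -> N}, forall x, f x = g (res_d P k x)
  end.
End Ext.

(* Ext^n(A, N) = 0, where Ext^n(A, N) = H^n(Hom(P, N)) does not depend on the
   choice of a projective resolution P of A; one exists, see
   projective_resolution_exists below. *)
Definition Ext_eq0 (R : pzRingType) (n : nat) (A N : lmodType R) : Prop :=
  forall (P : projective_resolution A) (f : {linear P n -> N}),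
    cocycle f -> coboundary f.

Section SemiRegular.
Variable R : comPzRingType.

(* Ideals of R are submodules of R^o, so I : submodClosed R^o may be improper;
   inQ is the set Q of finitely generated semi-regular ideals. *)
Definition dense_ideal (I : {pred R}) : Prop :=
  forall r, (forall a, a \in I -> a * r = 0) -> r = 0.

Definition fg_ideal (I : {pred R}) : Prop :=
  exists s : seq R, forall r, r \in I <->
    exists c : 'I_(size s) -> R, r = \sum_(i < size s) c i * s`_i.

Definition semiregular (I : {pred R}) : Prop :=
  exists J : submodClosed R^o,
    [/\ {subset J <= I}, fg_ideal J & dense_ideal J].

Definition inQ (I : submodClosed R^o) : Prop := fg_ideal I /\ semiregular I.

Definition Q_torsion_free (N : lmodType R) : Prop :=
  forall (I : submodClosed R^o) (n : N), inQ I ->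
    (forall a : R, a \in I -> a *: n = 0) -> n = 0.

Definition strongly_Lucas (N : lmodType R) : Prop :=
  Q_torsion_free N /\
  forall (I : submodClosed R^o) (n : nat), inQ I -> (1 <= n)%N ->
    Ext_eq0 n (quotmod I) N.

Definition tau_q_projective (M : lmodType R) : Prop :=
  forall N : lmodType R, strongly_Lucas N -> Ext_eq0 1 M N.
End SemiRegular.

Definition to_TRx (R : comNzRingType) :
    {rmorphism R -> total_quotient_ring {poly R}} :=
  @locring_in {poly R} (@regular_elts {poly R}) \o polyC.

Section FreeModule.
Variables (R : pzRingType) (X : choiceType).

(* Formal sums of pairs (r, x), identified when their coefficients agree. *)
Definition fcoef (x : seq (R * X)) (k : X) : R :=
  \sum_(p <- x | p.2 == k) p.1.
Definition free_eq (x y : seq (R * X)) : Prop := forall k, fcoef x k = fcoef y k.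
Definition free_scale (a : R) (x : seq (R * X)) := [seq (a * p.1, p.2) | p <- x].
Definition free_opp (x : seq (R * X)) := [seq (- p.1, p.2) | p <- x].

Lemma fcoef_cat x y k : fcoef (x ++ y) k = fcoef x k + fcoef y k.
Proof. by rewrite /fcoef big_cat. Qed.
Lemma fcoef_scale a x k : fcoef (free_scale a x) k = a * fcoef x k.
Proof. by rewrite /fcoef big_map mulr_sumr. Qed.
Lemma fcoef_opp x k : fcoef (free_opp x) k = - fcoef x k.
Proof. by rewrite /fcoef big_map sumrN. Qed.

Fact free_sym x y : free_eq x y -> free_eq y x.
Proof. by move=> e k. Qed.
Fact free_trans x y z : free_eq x y -> free_eq y z -> free_eq x z.
Proof. by move=> e f k; rewrite e. Qed.
Fact free_congrN x x' : free_eq x x' -> free_eq (free_opp x) (free_opp x').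
Proof. by move=> e k; rewrite !fcoef_opp e. Qed.
Fact free_congrD x x' y y' : free_eq x x' -> free_eq y y' ->
  free_eq (x ++ y) (x' ++ y').
Proof. by move=> e f k; rewrite !fcoef_cat e f. Qed.
Fact free_addA x y z : free_eq (x ++ (y ++ z)) ((x ++ y) ++ z).
Proof. by rewrite catA. Qed.
Fact free_addC x y : free_eq (x ++ y) (y ++ x).
Proof. by move=> k; rewrite !fcoef_cat addrC. Qed.
Fact free_addN x : free_eq (free_opp x ++ x) [::].
Proof. by move=> k; rewrite fcoef_cat fcoef_opp addNr /fcoef big_nil. Qed.

Definition free_pre := @PreZmod (seq (R * X)) free_eq [::] free_opp cat
  (fun x k => erefl) free_sym free_trans free_congrN free_congrD free_addA
  free_addC (fun x k => erefl) free_addN.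

Definition freemod : Type := quotZ free_pre.
HB.instance Definition _ := GRing.Zmodule.on freemod.

Definition free_cls (x : seq (R * X)) : freemod := qcls (x : free_pre).
Definition free_gen (k : X) : freemod := free_cls [:: (1, k)].

Lemma free_clsP x y : free_cls x = free_cls y <-> free_eq x y.
Proof. exact: (@qcls_eq free_pre). Qed.
Lemma free_clsD x y : free_cls (x ++ y) = free_cls x + free_cls y.
Proof. exact: (@qclsD free_pre). Qed.
Lemma free_ind (P : freemod -> Prop) : (forall x, P (free_cls x)) -> forall q, P q.
Proof. exact: (@quotZ_ind free_pre P). Qed.

Definition free_act (a : R) (q : freemod) : freemod := free_cls (free_scale a (qrep q)).

Lemma free_actE a x : free_act a (free_cls x) = free_cls (free_scale a x).
Proof.
apply/free_clsP => k; rewrite !fcoef_scale.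
by congr (_ * _); apply: (@qrep_cls free_pre).
Qed.

Fact free_actA a b q : free_act a (free_act b q) = free_act (a * b) q.
Proof.
elim/free_ind: q => x; rewrite !free_actE; apply/free_clsP => k.
by rewrite !fcoef_scale mulrA.
Qed.
Fact free_act1 : left_id 1 free_act.
Proof.
elim/free_ind=> x; rewrite free_actE; apply/free_clsP => k.
by rewrite fcoef_scale mul1r.
Qed.
Fact free_actDr : right_distributive free_act +%R.
Proof.
move=> a; elim/free_ind=> x; elim/free_ind=> y.
rewrite -free_clsD !free_actE -free_clsD; apply/free_clsP => k.
by rewrite fcoef_cat !fcoef_scale fcoef_cat mulrDr.
Qed.
Fact free_actDl q : {morph free_act^~ q : a b / a + b}.
Proof.
elim/free_ind: q => x a b; rewrite !free_actE -free_clsD; apply/free_clsP => k.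
by rewrite fcoef_cat !fcoef_scale mulrDl.
Qed.

HB.instance Definition _ := GRing.Zmodule_isLmodule.Build R freemod
  free_actA free_act1 free_actDr free_actDl.

Section Lift.
Variables (B : lmodType R) (h : X -> B).

Definition free_sum (x : seq (R * X)) : B := \sum_(p <- x) p.1 *: h p.2.

Lemma free_sumE (ks : seq X) x : uniq ks -> {subset [seq p.2 | p <- x] <= ks} ->
  free_sum x = \sum_(k <- ks) fcoef x k *: h k.
Proof.
move=> uks; elim: x => [|[r j] x IH] sub.
  by rewrite /free_sum big_nil big1 // => k _; rewrite /fcoef big_nil scale0r.
rewrite /free_sum big_cons -/(free_sum x) IH; last first.
  by move=> k kx; apply: sub; rewrite inE kx orbT.
have jks : j \in ks by apply: sub; rewrite inE eqxx.
rewrite (bigD1_seq j) //= [RHS](bigD1_seq j) //= addrA -scalerDl.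
congr (_ *: _ + _); first by rewrite /fcoef big_cons eqxx.
by apply: eq_bigr => k kj; rewrite /fcoef big_cons eq_sym (negPf kj).
Qed.

Lemma free_sum_congr x y : free_eq x y -> free_sum x = free_sum y.
Proof.
move=> e; pose ks := undup ([seq p.2 | p <- x] ++ [seq p.2 | p <- y]).
rewrite !(@free_sumE ks) ?undup_uniq //.
- by apply: eq_bigr => k _; rewrite e.
- by move=> k ky; rewrite mem_undup mem_cat ky orbT.
- by move=> k kx; rewrite mem_undup mem_cat kx.
Qed.

Definition free_lift (q : freemod) : B := free_sum (qrep q).

Lemma free_lift_cls x : free_lift (free_cls x) = free_sum x.
Proof. exact/free_sum_congr/(@qrep_cls free_pre). Qed.

Lemma free_lift_gen k : free_lift (free_gen k) = h k.
Proof. by rewrite free_lift_cls /free_sum big_seq1 scale1r. Qed.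

Fact free_lift_linear : linear free_lift.
Proof.
move=> a; elim/free_ind=> x; elim/free_ind=> y.
rewrite [a *: _](free_actE a x) -free_clsD !free_lift_cls /free_sum big_cat /=.
rewrite big_map scaler_sumr; congr (_ + _).
by apply: eq_bigr => p _; rewrite scalerA.
Qed.
HB.instance Definition _ := GRing.isLinear.Build R freemod B _ free_lift
  free_lift_linear.
End Lift.

Lemma free_linear_ext (B : lmodType R) (f g : {linear freemod -> B}) :
  (forall k, f (free_gen k) = g (free_gen k)) -> forall q, f q = g q.
Proof.
move=> fg; elim/free_ind; elim=> [|[r k] x IH].
  by have -> : free_cls [::] = 0 by []; rewrite !raddf0.
rewrite -cat1s free_clsD !linearD [X in _ + X = _]IH; congr (_ + _).
have -> : free_cls [:: (r, k)] = r *: free_gen k.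
  by rewrite [RHS](free_actE r) /= mulr1.
by rewrite !linearZ fg.
Qed.

Lemma free_projective : projective_module freemod.
Proof.
move=> A B g f g_surj.
have [h hE] : exists h : X -> A, forall k, g (h k) = f (free_gen k).
  have [h hE] := choice (fun k : X => g_surj (f (free_gen k))).
  by exists h.
exists (free_lift h) => q.
by apply: (free_linear_ext (f := g \o free_lift h)) => k /=; rewrite free_lift_gen.
Qed.
End FreeModule.

Section Kernel.
Variables (R : pzRingType) (U V : lmodType R) (f : {linear U -> V}).

Definition lker_pred : {pred U} := fun x => f x == 0.
Fact lker_submod_closed : GRing.subsemimod_closed lker_pred.
Proof.
have kerE x : (x \in lker_pred) = (f x == 0) by [].
split; first split; rewrite ?kerE ?linear0 //.
  by move=> x y; rewrite !kerE linearD => /eqP-> /eqP->; rewrite addr0.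
by move=> a x; rewrite !kerE linearZ /= => /eqP->; rewrite scaler0.
Qed.
HB.instance Definition _ :=
  GRing.isSubmodClosed.Build R U lker_pred lker_submod_closed.

Record kermod := Kermod { kermod_val :> U; _ : kermod_val \in lker_pred }.
HB.instance Definition _ := [isSub for kermod_val].
HB.instance Definition _ := [Choice of kermod by <:].
HB.instance Definition _ := [SubChoice_isSubLmodule of kermod by <:].

Lemma kermodP x : f x = 0 <-> exists y : kermod, val y = x.
Proof.
split=> [fx|[[y yf] <-]]; last exact/eqP.
have xk : x \in lker_pred by apply/eqP.
by exists (Kermod xk).
Qed.
End Kernel.

Section Resolution.
Variables (R : pzRingType) (A : lmodType R).

Definition free_cover (B : lmodType R) : {linear freemod R B -> B} :=
  free_lift (@id B).

Lemma free_cover_surj (B : lmodType R) (b : B) : exists x, free_cover B x = b.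
Proof. by exists (free_gen R b); rewrite /= free_lift_gen. Qed.

Fixpoint syzygy n : lmodType R :=
  if n is k.+1 then kermod (free_cover (syzygy k)) else A.

Definition free_res_d n : {linear freemod R (syzygy n.+1) -> freemod R (syzygy n)} :=
  (val : kermod (free_cover (syzygy n)) -> freemod R (syzygy n))
    \o free_cover (syzygy n.+1).

Lemma free_res_exact n x :
  free_cover (syzygy n) x = 0 <-> exists y, free_res_d n y = x.
Proof.
split=> [/kermodP[y <-]|[y <-]].
  by have [z zy] := free_cover_surj (y : syzygy n.+1); exists z; rewrite /= -zy.
by apply/kermodP; eexists; reflexivity.
Qed.

Definition free_resolution : projective_resolution A.
Proof.
refine (@ProjectiveResolution R A (fun n => freemod R (syzygy n)) free_res_d
  (free_cover A) _ (@free_cover_surj A) (@free_res_exact 0) _).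
  by move=> n; apply: free_projective.
move=> n x; rewrite -free_res_exact /=; split=> [e|-> //].
exact: val_inj.
Defined.
End Resolution.

Lemma projective_resolution_exists (R : pzRingType) (A : lmodType R) :
  inhabited (projective_resolution A).
Proof. exact: (inhabits (free_resolution A)). Qed.

(* Main.v *)
Require Import Defs.
From HB Require Import structures.
From mathcomp Require Import all_boot all_algebra.
From mathcomp Require Import boolp ring zify.
From mathcomp Require Import fingroup perm classical_sets.

(* Let T be an R-algebra with IT = T for every I in Q.  An element a of I kills
   R/I, hence acts on a projective resolution of R/I by a null-homotopic map,
   so a kills Ext^n(R/I, N); if N is a T-module, 1 is a T-combination of such
   elements and the Ext vanishes.  Thus every T-module is strongly Lucas over
   R, Ext^1_R(M, -) vanishes on T-modules, and the base change of M to T is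
   projective.  This applies to T(R[x]), because a polynomial whose
   coefficients generate a dense ideal is regular (McCoy), and to R_p, because
   no ideal in Q is contained in a non-semiregular prime.

   It remains to see that projective modules over a local ring are free
   (Kaplansky).  A splitting of a free cover of P gives generators x_k and
   coordinates phi_k with p = sum_k phi_k(p) x_k.  Zorn's lemma is applied to
   pairs (S, B) where phi_j(x_k) = 0 for k in S and j not in S, and B is a basis
   of the span of (x_k)_{k in S}.  Such a span is a direct summand; to enlarge
   S, close it under countably many further indices and split off, one x_k at a
   time, finite free summands complementary to it. *)

Set Implicit Arguments.
Unset Strict Implicit.
Unset Printing Implicit Defensive.

Import GRing.Theory.
Local Open Scope ring_scope.

(** * Base change of tau_q-projective modules *)

Section LinearMaps.
Variable R : pzRingType.

Definition linear_of (U V : lmodType R) (f : U -> V) (f_lin : linear f) :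
    {linear U -> V} :=
  HB.pack f (GRing.isLinear.Build R U V *:%R f f_lin).

(** Projectivity is stated for surjective [g]; here [g] need only reach the values of [f]. The
    pullback of [f] and [g] surjects onto [P], and the first component of a section is the lift. *)
Lemma projective_lift (P A B : lmodType R) (g : {linear A -> B})
    (f : {linear P -> B}) :
    projective_module P -> (forall x, exists a, g a = f x) ->
  exists h : {linear P -> A}, forall x, g (h x) = f x.
Proof.
move=> projP gf.
have dlin : linear (fun u : (A * P)%type => g u.1 - f u.2).
  by move=> a [u u'] [v v'] /=; rewrite (linearP g) (linearP f) scalerBr opprD addrACA.
pose d := linear_of dlin.
have qlin : linear (fun u : kermod d => (val u).2) by move=> a u v.
have [|s sE] := projP _ _ (linear_of qlin) (linear_of (f := @id P) (fun _ _ _ => erefl)).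
  move=> x; have [a ax] := gf x.
  have /kermodP[u ux] : d (a, x) = 0 by rewrite /= ax subrr.
  by exists u; rewrite /= ux.
have hlin : linear (fun x => (val (s x)).1) by move=> a x y; rewrite linearP.
exists (linear_of hlin) => x /=.
have /eqP : d (val (s x)) = 0 by apply/kermodP; exists (s x).
by rewrite /= subr_eq0 => /eqP ->; have /= -> := sE x.
Qed.

(** A set-theoretic section [s] of [p] is linear up to the kernel of [p], on which [f] vanishes, so
    [f \o s] is linear. *)
Lemma linear_factor (U V W : lmodType R) (p : {linear U -> V})
    (f : {linear U -> W}) :
    (forall v, exists u, p u = v) -> (forall u, p u = 0 -> f u = 0) ->
  exists h : {linear V -> W}, forall u, h (p u) = f u.
Proof.
move=> /choice[s sE] pf.
have fs u : f (s (p u)) = f u.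
  by apply/eqP; rewrite -subr_eq0 -linearB pf // linearB sE subrr.
have hlin : linear (f \o s).
  by move=> a u v; rewrite /= -linearP -[RHS]fs linearP !sE.
by exists (linear_of hlin).
Qed.
End LinearMaps.

(** * Null-homotopies from annihilators *)

Section Homotopy.
Variables (R : comPzRingType) (A : lmodType R) (P : projective_resolution A).
Variable a : R.
Hypothesis aA : forall x : A, a *: x = 0.

(* Multiplication by [a] lifts the zero map of [A], so it is null-homotopic;
   the identity [d s d = a d] is the part of the homotopy relation that is
   stable under the induction. *)
Lemma null_homotopy n : exists s : {linear P n -> P n.+1},
  forall y, res_d P n (s (res_d P n y)) = a *: res_d P n y.
Proof.
elim: n => [|n [s sE]].
  have mlin : linear (fun x : P 0 => a *: x).
    by move=> b x y; rewrite scalerDr !scalerA mulrC.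
  have [x|s sE] := projective_lift (g := res_d P 0) (f := linear_of mlin)
    (@res_projective _ _ P 0).
    by apply/res_aug_exact; rewrite /= linearZ /= aA.
  by exists s => y; rewrite sE.
have mlin : linear (fun x : P n.+1 => a *: x - s (res_d P n x)).
  move=> b x y; rewrite (linearP (res_d P n)) (linearP s) scalerDr.
  by rewrite scalerA mulrC -scalerA scalerBr opprD addrACA.
(* By [sE] the map [a x - s (d x)] takes values in cycles, so it lifts through the next
   differential; on boundaries its second term vanishes. *)
have [x|t tE] := projective_lift (g := res_d P n.+1) (f := linear_of mlin)
  (@res_projective _ _ P n.+1).
  by apply/res_exact; rewrite /= linearB linearZ /= sE subrr.
exists t => y; rewrite tE /=.
have -> : res_d P n (res_d P n.+1 y) = 0 by apply/res_exact; exists y.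
by rewrite linear0 subr0.
Qed.

(** As [a x - s (d x)] is a cycle, hence a boundary, [f] vanishes on it; thus [a f] is the
    coboundary of [f \o s]. *)
Lemma scaled_cocycle (N : lmodType R) n (f : {linear P n.+1 -> N}) :
    cocycle f ->
  exists g : {linear P n -> N}, forall x, a *: f x = g (res_d P n x).
Proof.
move=> fd; have [s sE] := null_homotopy n.
exists (linear_of (f := f \o s) (fun b x y => etrans (congr1 f (linearP s b x y))
  (linearP f b (s x) (s y)))) => x /=.
rewrite -linearZ; apply/eqP; rewrite -subr_eq0 -linearB.
have /res_exact[y <-] : res_d P n (a *: x - s (res_d P n x)) = 0.
  by rewrite linearB linearZ /= sE subrr.
by rewrite fd.
Qed.
End Homotopy.

(* [phi] is a phantom argument, from which the R-action is inferred. *)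
Definition restr (R T : comPzRingType) (phi : {rmorphism R -> T})
  (N : lmodType T) : Type := N.

(** * Restriction of scalars and base change *)

Section Restriction.
Variables (R T : comPzRingType) (phi : {rmorphism R -> T}).

HB.instance Definition _ (N : lmodType T) := GRing.Zmodule.on (restr phi N).

Section Scale.
Variable N : lmodType T.
Definition restr_scale (r : R) (x : restr phi N) : restr phi N := phi r *: (x : N).

Fact restr_scaleA a b x : restr_scale a (restr_scale b x) = restr_scale (a * b) x.
Proof. by rewrite /restr_scale scalerA rmorphM. Qed.
Fact restr_scale1 : left_id 1 restr_scale.
Proof. by move=> x; rewrite /restr_scale rmorph1 scale1r. Qed.
Fact restr_scaleDr : right_distributive restr_scale +%R.
Proof. by move=> a x y; rewrite /restr_scale scalerDr. Qed.
Fact restr_scaleDl x : {morph restr_scale^~ x : a b / a + b}.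
Proof. by move=> a b; rewrite /restr_scale rmorphD scalerDl. Qed.
HB.instance Definition _ := GRing.Zmodule_isLmodule.Build R (restr phi N)
  restr_scaleA restr_scale1 restr_scaleDr restr_scaleDl.

Lemma restr_scaleE (r : R) (x : restr phi N) : r *: x = phi r *: (x : N).
Proof. by []. Qed.
End Scale.

Fact restr_linear (A B : lmodType T) (g : {linear A -> B}) :
  linear (g : restr phi A -> restr phi B).
Proof. by move=> a x y; rewrite !restr_scaleE linearP. Qed.
Definition restr_map (A B : lmodType T) (g : {linear A -> B}) :
  {linear restr phi A -> restr phi B} := linear_of (restr_linear g).

Definition extends_to_unit (I : {pred R}) : Prop :=
  exists (n : nat) (a : 'I_n -> R) (t : 'I_n -> T),
    (forall i, a i \in I) /\ \sum_i t i * phi (a i) = 1.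

Hypothesis Q_unit : forall I : submodClosed R^o, inQ I -> extends_to_unit I.

Lemma restr_strongly_Lucas (N : lmodType T) : strongly_Lucas (restr phi N).
Proof.
split=> [I x /Q_unit[n [a [t [aI at1]]]] Ix | I [//|n] QI _ P f fd].
  rewrite -[x](@scale1r T N) -at1 scaler_suml big1 // => i _.
  by rewrite -scalerA -[phi _ *: _]restr_scaleE Ix // scaler0.
have [m [a [t [aI at1]]]] := Q_unit QI.
have aA i (x : quotmod I) : a i *: x = 0.
  elim/quotmod_ind: x => x; rewrite [_ *: _]quotmod_scaleE; apply/quotmod_piP.
  rewrite subr0; have -> : a i *: x = (x : R) *: (a i : R^o) by exact: mulrC.
  exact: rpredZ.
have /choice[g gE] : forall i, exists g : {linear P n -> restr phi N},
    forall x, a i *: f x = g (res_d P n x).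
  by move=> i; apply: scaled_cocycle.
(* The coboundaries [a i f = g i d] are combined as in [1 = sum t i a i]; commutativity of [T] keeps
   the combination linear over [R]. *)
have hlin : linear (fun x => (\sum_i t i *: (g i x : N)) : restr phi N).
  move=> b x y; rewrite restr_scaleE scaler_sumr -big_split /=.
  apply: eq_bigr => i _; rewrite linearP scalerDr; congr (_ + _).
  by rewrite restr_scaleE !scalerA mulrC.
exists (linear_of hlin) => x /=.
rewrite -[LHS](@scale1r T N) -at1 scaler_suml; apply: eq_bigr => i _.
by rewrite -gE restr_scaleE scalerA.
Qed.

(** The two hypotheses on [j] are the universal property of base change, so that tensor products and
    localizations are treated alike. The obstruction to lifting along [g] is a class in Ext^1 of [M]
    with values in the kernel of [g]. *)
Lemma base_change_projective (M : lmodType R) (MT : lmodType T)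
    (j : {linear M -> restr phi MT}) :
    (forall (N : lmodType T) (f : {linear M -> restr phi N}),
       exists h : {linear MT -> N}, forall m, h (j m) = f m) ->
    (forall (N : lmodType T) (f g : {linear MT -> N}),
       (forall m, f (j m) = g (j m)) -> forall x, f x = g x) ->
  tau_q_projective M -> projective_module MT.
Proof.
move=> j_ext j_uniq tauM A B g f g_surj.
pose P := free_resolution M; pose gR := restr_map g.
have fj_lin : linear (fun x : P 0 => (f (j (res_aug P x)) : restr phi B)).
  by move=> a x y; rewrite !linearP restr_scaleE -linearP.
have [l lE] : exists l : {linear P 0 -> restr phi A},
    forall x, gR (l x) = linear_of fj_lin x.
  by apply: projective_lift => [|x]; [exact: res_projective | exact: g_surj].
have kd y : g (l (res_d P 0 y)) = 0.
  rewrite [LHS]lE /=; have -> : free_cover M (free_res_d M 0 y) = 0.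
    by apply/(@res_aug_exact _ _ P); exists y.
  by rewrite !linear0.
have kP (y : P 1) : exists z : kermod g, val z = l (res_d P 0 y).
  exact/kermodP/kd.
(* On boundaries the lift [l] lands in the kernel of [g]; this is the 1-cocycle obstructing the
   descent of [l] to [M]. *)
have [k kE] := choice kP.
have klin : linear (k : P 1 -> restr phi (kermod g)).
  move=> a x y; apply: val_inj; rewrite restr_scaleE linearP /= !kE.
  by rewrite (linearP (res_d P 0)) (linearP l).
have [y|u uE] := tauM _ (restr_strongly_Lucas (kermod g)) P (linear_of klin).
  apply: val_inj; rewrite /= kE.
  by have -> : res_d P 0 (res_d P 1 y) = 0;
    [apply/(@res_exact _ _ P); exists y | rewrite linear0].
(* Subtracting the cochain [u] makes the lift vanish on boundaries, so it factors through [M]. *)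
have h0lin : linear (fun x : P 0 => l x - (val (u x : kermod g)) : restr phi A).
  by move=> a x y; rewrite (linearP l) (linearP u) /= scalerBr opprD addrACA.
have [||h0 h0E] := linear_factor (p := res_aug P) (f := linear_of h0lin).
- exact: res_aug_surj.
- by move=> x /res_aug_exact[y <-] /=; rewrite -[u _]uE /= kE subrr.
have [h hE] := j_ext _ h0; exists h => x.
apply: (j_uniq _ (g \o h)) => m /=; rewrite hE.
have [x' <-] := res_aug_surj P m; rewrite h0E /= linearB.
have -> : g (val (u x' : kermod g)) = 0 by apply/kermodP; eexists.
by rewrite subr0; apply: lE.
Qed.
End Restriction.

(** * The total quotient ring of R[x] and the localization at a prime *)

(* McCoy: if [g] is a nonzero annihilator of [f] of least degree, then every
   coefficient of [f] kills [g]. *)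
Lemma regular_poly (R : comNzRingType) (f : {poly R}) :
  (forall r, (forall i, f`_i * r = 0) -> r = 0) -> GRing.lreg f.
Proof.
move=> densef; have kill n (g : {poly R}) : (size g <= n)%N -> f * g = 0 -> g = 0.
  elim: n g => [|n IH] g; first by rewrite leqn0 size_poly_eq0 => /eqP.
  move=> gn fg0; apply/eqP/negPn/negP => g0; have g_gt0 : (0 < size g)%N.
    by rewrite lt0n size_poly_eq0.
  (* [h] starts as [f] and loses its top term at each step. *)
  have coefs0 m (h : {poly R}) : (size h <= m)%N -> h * g = 0 ->
      (forall i, exists c, h`_i = c * f`_i) -> forall i, h`_i *: g = 0.
    elim: m h => [|m IHm] h hm hg0 hf i.
      by move: hm; rewrite leqn0 size_poly_eq0 => /eqP->; rewrite coef0 scale0r.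
    (* The top coefficient of [h] kills that of [g]; multiplying [g] by it gives an annihilator of
       [f] of smaller size, zero by [IH]. *)
    have top : h`_m *: g = 0.
      have [c cE] := hf m; apply: IH; last first.
        by rewrite cE -scalerA -scalerAr -scalerAr fg0 !scaler0.
      rewrite -ltnS (leq_trans _ gn) //.
      have lead0 : (h`_m *: g)`_(size g).-1 = 0.
        have := congr1 (fun q : {poly R} => q`_(m + (size g).-1)) hg0.
        rewrite coefM coef0 (bigD1 (Ordinal (leq_addr _ _ : m < _)%N)) //=.
        rewrite addKn coefZ big1 ?addr0 // => j jm.
        have [jm'|mj] := ltnP j m.
          rewrite [g`_ _]nth_default ?mulr0 //.
          by move: g_gt0 {jm}; move: (val j) jm'; case: (size g) => // k; lia.
        rewrite [h`_ _]nth_default ?mul0r // (leq_trans hm) //.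
        rewrite ltn_neqAle mj andbT eq_sym; apply: contra jm => /eqP jm.
        by apply/eqP/val_inj.
      rewrite ltn_neqAle (leq_trans (size_scale_leq _ _)) // andbT.
      apply/eqP => sz; have : lead_coef (h`_m *: g) = 0.
        by rewrite /lead_coef sz.
      by move/eqP; rewrite lead_coef_eq0 -size_poly_eq0 sz -leqn0 leqNgt g_gt0.
    have [->//|im] := eqVneq i m.
    have := IHm (h - h`_m *: 'X^m) _ _ _ i.
    rewrite coefB coefZ coefXn (negPf im) mulr0 subr0; apply.
    - apply/leq_sizeP => j mj; rewrite coefB coefZ coefXn.
      have [->|jm] := eqVneq j m; first by rewrite mulr1 subrr.
      by rewrite mulr0 subr0 nth_default // (leq_trans hm) // ltn_neqAle eq_sym jm.
    - by rewrite mulrBl hg0 -scalerAl mulrC scalerAl top mul0r subrr.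
    move=> k; have [c cE] := hf k; rewrite coefB coefZ coefXn.
    by case: eqVneq => [->|_]; [exists 0; rewrite mulr1 subrr mul0r
      | exists c; rewrite mulr0 subr0].
  case/eqP: g0; apply/polyP => k; rewrite coef0; apply: densef => i.
  have f1 j : exists c, f`_j = c * f`_j by exists 1; rewrite mul1r.
  by rewrite -coefZ (coefs0 _ f (leqnn _) fg0 f1 i) coef0.
move=> g h fgh; apply/eqP; rewrite -subr_eq0; apply/eqP.
by apply: (kill _ _ (leqnn _)); rewrite mulrBr fgh subrr.
Qed.

(** An annihilator of generators of [I] annihilates the dense ideal inside [I], hence is zero.
    Entries beyond the end of [s] are 0 and impose nothing. *)
Lemma inQ_gens (R : comPzRingType) (I : submodClosed R^o) : inQ I ->
  exists s : seq R, {subset s <= I} /\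
    forall r, (forall i, s`_i * r = 0) -> r = 0.
Proof.
case=> -[s sE] [J [JI _ Jdense]]; exists s; split=> [a /(nthP 0)[i si <-]|r rs].
  apply/sE; exists (fun j => (val j == i)%:R).
  rewrite (bigD1 (Ordinal si)) //= eqxx mul1r big1 ?addr0 // => j ji.
  by rewrite (_ : (_ == i) = false) ?mul0r //; apply: contraNF ji => /eqP ji;
    apply/eqP/val_inj.
apply: Jdense => a /JI/sE[c ->]; rewrite mulr_suml big1 // => i _.
by rewrite -mulrA rs mulr0.
Qed.

(** The polynomial f = sum s_i x^i is regular by McCoy, and 1 = sum (x^i / f) s_i. *)
Lemma TRx_extends_to_unit (R : comNzRingType) (I : submodClosed R^o) :
  inQ I -> extends_to_unit (to_TRx R) I.
Proof.
case/inQ_gens=> s [sI sdense]; pose f : {poly R} := \poly_(i < size s) s`_i.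
have fE i : f`_i = s`_i.
  by rewrite coef_poly; case: ltnP => // ?; rewrite nth_default.
have freg : f \in @regular_elts {poly R}.
  by apply/asboolP/regular_poly => r rf; apply: sdense => i; rewrite -fE.
exists (size s), (fun i => s`_i),
  (fun i : 'I_(size s) => rfrac ('X^i : {poly R}) (exist _ f freg)).
split=> [i|]; first exact/sI/mem_nth.
have -> : \sum_(i < size s) rfrac 'X^i (exist _ f freg) * to_TRx R s`_i =
    rfrac 1 (exist _ f freg) * locring_in _ (\sum_(i < size s) s`_i *: 'X^i).
  rewrite raddf_sum mulr_sumr; apply: eq_bigr => i _.
  rewrite [LHS]rfracM [RHS]rfracM; apply: frac_eq => //=.
  by rewrite mul1r mulrC mul_polyC.
rewrite -poly_def -/f [LHS]rfracM; apply/fracP; exists 1; rewrite ?rpred1 //=.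
by rewrite mul1r !mulr1 !scale1r [X in _ - X](mulr1 f) subrr.
Qed.

(** * Universal property of the tensor product *)

Section TensorUniversal.
Variables (R T : comPzRingType) (phi : {rmorphism R -> T}) (M : lmodType R).

Lemma tens_in_linear : linear (fun m : M => (tens phi m 1 : restr phi (tensor phi M))).
Proof.
move=> a m n; rewrite restr_scaleE.
have -> : phi a *: tens phi m 1 = tens phi (a *: m) 1.
  rewrite [LHS](tensor_scaleE _ (phi a)); apply/tens_clsP/tens_sym; exact: tens_bal.
by rewrite -tens_clsD; apply/tens_clsP/tens_Dl.
Qed.
Definition tens_in := linear_of tens_in_linear.

Lemma tens_clsE x : tens_cls phi x = \sum_(mt <- x) mt.2 *: (tens_in mt.1 : tensor phi M).
Proof.
elim: x => [|[m t] x IH]; first by rewrite big_nil.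
rewrite big_cons -IH -cat1s tens_clsD; congr (_ + _).
by rewrite [RHS](tensor_scaleE _ t) /= mulr1.
Qed.

Lemma tensor_linear_ext (N : lmodType T) (f g : {linear tensor phi M -> N}) :
  (forall m, f (tens_in m) = g (tens_in m)) -> forall x, f x = g x.
Proof.
move=> fg; elim/tensor_ind=> x; rewrite tens_clsE !linear_sum.
by apply: eq_bigr => mt _; rewrite !linearZ fg.
Qed.

(** The evaluation [F] of formal sums respects each generator of the congruence, hence descends to
    classes. *)
Lemma tensor_lift (N : lmodType T) (f : {linear M -> restr phi N}) :
  exists h : {linear tensor phi M -> N}, forall m, h (tens_in m) = f m.
Proof.
pose F (x : seq (M * T)) : N := \sum_(mt <- x) mt.2 *: (f mt.1 : N).
have F1 m t : F [:: (m, t)] = t *: (f m : N) by rewrite /F big_seq1.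
have F2 x y : F (x ++ y) = F x + F y by rewrite /F big_cat.
have FC m t x : F ((m, t) :: x) = t *: (f m : N) + F x by rewrite /F big_cons.
have FE x y : tens_eq phi x y -> F x = F y.
  elim=> [//|//|? y' ? _ -> _ -> //|? ? ? ? _ e1 _ e2|? ?|t|m n t|m t u|r m t].
  - by rewrite !F2 e1 e2.
  - by rewrite !F2 addrC.
  - by rewrite F1 /F big_nil linear0 scaler0.
  - by rewrite [RHS]FC !F1 linearD scalerDr.
  - by rewrite [RHS]FC !F1 scalerDl.
  - by rewrite !F1 linearZ /= restr_scaleE scalerA mulrC.
have hE x : F (qrep (tens_cls phi x : tensor phi M)) = F x.
  exact/FE/(@qrep_cls (tens_pre phi M)).
have hlin : linear (fun q : tensor phi M => F (qrep q)).
  move=> a; elim/tensor_ind=> x; elim/tensor_ind=> y.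
  rewrite [a *: _](tensor_scaleE _ a) -tens_clsD !hE F2; congr (_ + _).
  by rewrite /F big_map scaler_sumr; apply: eq_bigr => mt _; rewrite scalerA.
by exists (linear_of hlin) => m; rewrite /= hE F1 scale1r.
Qed.
End TensorUniversal.

Lemma tau_q_projective_TRx (R : comNzRingType) (M : lmodType R) :
  tau_q_projective M ->
  @projective_module (total_quotient_ring {poly R}) (tensor (to_TRx R) M).
Proof.
apply: (@base_change_projective _ _ _ _ _ _ (tens_in (to_TRx R) M)).
- exact: TRx_extends_to_unit.
- exact: tensor_lift.
- exact: tensor_linear_ext.
Qed.

(** * Universal property of the localization *)

Section LocalizationUniversal.
Variables (A : comPzRingType) (S : mulrClosed A) (M : lmodType A).

Local Notation denom := {s : A | s \in S}.

Definition loc_hom : {rmorphism A -> locring S} := locring_in S.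

Fact loc_hom_mfrac a (m : M) s : loc_hom a *: mfrac m s = mfrac (a *: m) s.
Proof. by rewrite [LHS]loc_scaleE; apply: frac_eq; rewrite //= mul1r. Qed.

Lemma loc_in_linear :
  linear (fun m : M => (mfrac m (denom1 S) : restr loc_hom (locmod S M))).
Proof.
move=> a m n; rewrite restr_scaleE loc_hom_mfrac fracD /=.
by apply: frac_eq; rewrite /= ?mul1r // !scale1r.
Qed.
Definition loc_in := linear_of loc_in_linear.

Lemma loc_homV (s : denom) : rfrac 1 s * loc_hom (sval s) = 1.
Proof.
rewrite [LHS]rfracM mul1r; apply/fracP; exists 1; rewrite ?rpred1 //=.
by rewrite !mulr1 !scale1r [X in _ - X](mulr1 (sval s)) subrr.
Qed.

Lemma mfracE (m : M) s : mfrac m s = rfrac 1 s *: (loc_in m : locmod S M).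
Proof. by rewrite [RHS]loc_scaleE scale1r; apply: frac_eq; rewrite //= mulr1. Qed.

Lemma locmod_linear_ext (N : lmodType (locring S)) (f g : {linear locmod S M -> N}) :
  (forall m, f (loc_in m) = g (loc_in m)) -> forall x, f x = g x.
Proof. by move=> fg; elim/locmod_ind=> m s; rewrite mfracE !linearZ fg. Qed.

(** The fraction m/s goes to s^-1 f(m). Denominators act invertibly on [N], so identities are
    checked after clearing them. *)
Lemma locmod_lift (N : lmodType (locring S)) (f : {linear M -> restr loc_hom N}) :
  exists h : {linear locmod S M -> N}, forall m, h (loc_in m) = f m.
Proof.
pose F (x : M * denom) : N := rfrac 1 x.2 *: (f x.1 : N).
have inv_eq (s : denom) (y z : N) :
    loc_hom (sval s) *: y = loc_hom (sval s) *: z -> y = z.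
  by move/(congr1 (fun x => rfrac 1 s *: x)); rewrite !scalerA loc_homV !scale1r.
have FK m s : loc_hom (sval s) *: F (m, s) = f m.
  by rewrite scalerA mulrC loc_homV scale1r.
have FE x y : loc_eq x y -> F x = F y.
  case: x y => [m s] [n t] [u uS /= /(congr1 f)].
  rewrite linear0 linearZ linearB !linearZ /= !restr_scaleE => e.
  apply: (inv_eq (denomM (exist _ u uS) (denomM s t))) => /=.
  rewrite !rmorphM -!scalerA FK; apply/eqP.
  rewrite [loc_hom (sval s) *: _]scalerA [loc_hom (sval s) * _]mulrC -scalerA FK.
  by rewrite -subr_eq0 -scalerBr -scalerN e.
have hE m s : F (qrep (mfrac m s)) = F (m, s).
  exact/FE/(@qrep_cls (loc_pre S M)).
have FZ a m s t : F (a *: m, denomM t s) = rfrac a t *: F (m, s).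
  rewrite /F /= linearZ /= restr_scaleE !scalerA; congr (_ *: _).
  by rewrite [LHS]rfracM [RHS]rfracM; apply: frac_eq; rewrite /= ?mulr1 ?mul1r.
have FD m s n t : F (sval t *: m + sval s *: n, denomM s t) = F (m, s) + F (n, t).
  apply: (inv_eq (denomM s t)); rewrite FK scalerDr /= !rmorphM.
  rewrite -[in X in _ = _ + X]scalerA [loc_hom (sval s) * _]mulrC -scalerA !FK.
  by rewrite linearD !linearZ.
have hlin : linear (fun q : locmod S M => F (qrep q)).
  move=> a; elim/locmod_ind=> m s; elim/locmod_ind=> n t.
  elim/locring_ind: a => a u.
  by rewrite [_ *: mfrac m s]loc_scaleE fracD !hE FD FZ.
exists (linear_of hlin) => m; rewrite /= hE.
by rewrite -[RHS](FK m (denom1 S)) rmorph1 scale1r.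
Qed.
End LocalizationUniversal.

Lemma semiregular_extends_to_unit (R : comNzRingType) (p : prime_idealr R) :
  ~ semiregular p -> forall I : submodClosed R^o, inQ I ->
  extends_to_unit (loc_hom (@prime_compl R p)) I.
Proof.
move=> np I [_ [J [JI Jfg Jdense]]].
have [a aI ap] : exists2 a : R, a \in I & a \notin p.
  apply: contrapT => h; apply: np; exists J; split=> // a aJ.
  by apply/negPn/negP => ap; apply: h; exists a; first exact: JI.
pose s : {s : R | s \in @prime_compl R p} := exist _ a ap.
by exists 1, (fun=> a), (fun=> rfrac 1 s); split=> //; rewrite big_ord1 loc_homV.
Qed.

Lemma tau_q_projective_at_prime (R : comNzRingType) (M : lmodType R)
    (p : prime_idealr R) :
  tau_q_projective M -> ~ semiregular p ->
  @projective_module (ring_at_prime p) (mod_at_prime p M).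
Proof.
move=> tauM np.
apply: (@base_change_projective _ _ _ _ _ _ (loc_in (@prime_compl R p) M)) tauM.
- exact: semiregular_extends_to_unit.
- exact: locmod_lift.
- exact: locmod_linear_ext.
Qed.

(** * Kaplansky's theorem *)

Section LocalRing.
Variable R : comPzRingType.

Definition invertible (a : R) : Prop := exists u, u * a = 1.
Definition local_ring : Prop :=
  ~ invertible 0 /\
  forall a b, invertible (a + b) -> invertible a \/ invertible b.

Lemma invertibleM a b : invertible (a * b) <-> invertible a /\ invertible b.
Proof.
split=> [[u uab]|[[u ua] [v vb]]].
  by split; [exists (u * b) | exists (u * a)]; rewrite -uab; ring.
by exists (u * v); rewrite mulrACA ua vb mulr1.
Qed.

Lemma invertible_prod (I : finType) (F : I -> R) :
  invertible (\prod_i F i) <-> forall i, invertible (F i).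
Proof.
split=> [iF i|iF]; first by move: iF; rewrite (bigD1 i) // => /invertibleM[].
apply: (big_ind invertible) => [|a b ia ib|//]; last exact/invertibleM.
by exists 1; rewrite mulr1.
Qed.

Hypothesis locR : local_ring.

Lemma ninvertible_sum (I : finType) (Q : pred I) (F : I -> R) :
  (forall i, Q i -> ~ invertible (F i)) -> ~ invertible (\sum_(i | Q i) F i).
Proof.
move=> nF; apply: (big_ind (fun a => ~ invertible a)) => // [|a b na nb].
  exact: locR.1.
by move/locR.2 => -[].
Qed.

(** In the Leibniz expansion the identity permutation contributes a product of units; any other
    permutation contributes a non-unit, having an off-diagonal factor [- D i (s i)]. *)
Lemma invertible_det_1B n (D : 'M[R]_n) :
  (forall i j, ~ invertible (D i j)) -> invertible (\det (1%:M - D)).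
Proof.
move=> nD; apply: contrapT => ndet.
have inv1 : invertible (\prod_i (1 - D i i)).
  apply/invertible_prod => i; have [|//|/nD//] := locR.2 (1 - D i i) (D i i).
  by rewrite subrK; exists 1; rewrite mulr1.
move: inv1; have -> : \prod_i (1 - D i i) = \det (1%:M - D) +
    - \sum_(s : 'S_n | s != 1%g) (-1) ^+ s * \prod_i (1%:M - D) i (s i).
  rewrite /determinant (bigD1 1%g) //= addrK odd_perm1 mul1r.
  by apply: eq_bigr => i _; rewrite !mxE perm1 eqxx.
case/locR.2 => // -[u]; rewrite mulrN -mulNr => uS.
suff: ~ invertible (\sum_(s : 'S_n | s != 1%g)
    (-1) ^+ s * \prod_i (1%:M - D) i (s i)) by apply; exists (- u).
apply: ninvertible_sum => s s1 /invertibleM[_ /invertible_prod inv_s].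
suff [i si] : exists i, s i != i.
  have [v] := inv_s i; rewrite !mxE eq_sym (negPf si) sub0r mulrN -mulNr => vD.
  by apply: (nD i (s i)); exists (- v).
apply: contrapT => h; case/eqP: s1; apply/permP => i; rewrite perm1.
by apply: contrapT => /eqP si; apply: h; exists i.
Qed.
End LocalRing.

(** * Spans and independence modulo a submodule *)

Section Span.
Variables (R : pzRingType) (P : lmodType R).

Definition span_closed (V : P -> Prop) : Prop :=
  V 0 /\ forall a u v, V u -> V v -> V (a *: u + v).

Lemma span_closedD V u v : span_closed V -> V u -> V v -> V (u + v).
Proof. by move=> [_ Vl] Vu Vv; rewrite -[u]scale1r; apply: Vl. Qed.

Lemma span_closedZ V a u : span_closed V -> V u -> V (a *: u).
Proof. by move=> [V0 Vl] Vu; rewrite -[_ *: _]addr0; apply: Vl. Qed.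

Lemma span_closedB V u v : span_closed V -> V u -> V v -> V (u - v).
Proof. by move=> [_ Vl] Vu Vv; rewrite addrC -scaleN1r; apply: Vl. Qed.

Lemma span_closed_sum V (I : Type) (s : seq I) (Q : pred I) (c : I -> R) F :
  span_closed V -> (forall i, Q i -> V (F i)) ->
  V (\sum_(i <- s | Q i) c i *: F i).
Proof.
move=> clV VF; apply: (big_ind V) => [|u v|i /VF]; first exact: clV.1.
  exact: span_closedD.
exact: span_closedZ.
Qed.

(** Impredicative, so that minimality holds by definition; [lspanP] recovers finite combinations. *)
Definition lspan (D : P -> Prop) (p : P) : Prop :=
  forall V, span_closed V -> (forall d, D d -> V d) -> V p.

Lemma mem_lspan (D : P -> Prop) d : D d -> lspan D d.
Proof. by move=> Dd V _; apply. Qed.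

Lemma lspan_closed D : span_closed (lspan D).
Proof.
split=> [V [] //|a u v Du Dv V clV VD].
by apply: clV.2; [apply: Du | apply: Dv].
Qed.

Lemma lspan_min (D V : P -> Prop) p :
  span_closed V -> (forall d, D d -> V d) -> lspan D p -> V p.
Proof. by move=> clV DV; apply. Qed.

Lemma lspanP (D : P -> Prop) p : lspan D p ->
  exists (s : seq P) (c : P -> R),
    (forall b, b \in s -> D b) /\ p = \sum_(b <- s) c b *: b.
Proof.
have: span_closed (fun q => exists l : seq (R * P),
    (forall b, b \in [seq rb.2 | rb <- l] -> D b) /\ q = free_sum id l).
  split=> [|a u v [l [lD ->]] [k [kD ->]]].
    by exists [::]; rewrite /free_sum big_nil.
  exists (free_scale a l ++ k); split=> [b|].
    rewrite map_cat mem_cat -map_comp.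
    by case/orP=> [/mapP[rb rbl ->]|/kD//]; apply: lD; apply: map_f.
  rewrite /free_sum big_cat /= big_map scaler_sumr; congr (_ + _).
  by apply: eq_bigr => rb _; rewrite scalerA.
move/[swap]=> /[apply]-[d Dd|l [lD ->]].
  exists [:: (1, d)]; rewrite /free_sum big_seq1 scale1r; split=> // b.
  by rewrite inE => /eqP->.
(* A vector may occur several times in [l]; [fcoef] adds up its coefficients. *)
exists (undup [seq rb.2 | rb <- l]), (fcoef l); split=> [b|].
  by rewrite mem_undup; apply: lD.
by apply: free_sumE; [exact: undup_uniq | move=> b; rewrite mem_undup].
Qed.

(** When [W] is a submodule, this is linear independence in the quotient by [W]; [eq^~ 0] gives the
    ordinary notion. *)
Definition indep_mod (W D : P -> Prop) : Prop :=
  forall (s : seq P) (c : P -> R), uniq s -> (forall b, b \in s -> D b) ->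
    W (\sum_(b <- s) c b *: b) -> forall b, b \in s -> c b = 0.

(** In a combination lying in [W], the terms from [D] lie in [W'], hence so do those from [D'],
    whose coefficients vanish; a combination of [D] in [W] remains. *)
Lemma indep_modU (W W' D D' : P -> Prop) :
    span_closed W' -> (forall p, W p -> W' p) -> (forall d, D d -> W' d) ->
    indep_mod W D -> indep_mod W' D' ->
  indep_mod W (fun p => D p \/ D' p).
Proof.
move=> clW' WW' DW' iD iD' s c us sDD' Ws.
have sD b : b \in s -> ~ D' b -> D b by move=> /sDD'[].
rewrite (bigID (fun b => `[< D' b >])) /= in Ws.
have c0 b : b \in s -> D' b -> c b = 0.
  move=> bs D'b; apply: (iD' [seq b <- s | `[< D' b >]]).
  - exact: filter_uniq.
  - by move=> d; rewrite mem_filter => /andP[/asboolP].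
  - rewrite big_filter -[X in W' X](addrK (\sum_(i <- s | ~~ `[< D' i >]) c i *: i)).
    apply: span_closedB => //; first exact: WW'.
    rewrite big_seq_cond; apply: span_closed_sum => // d /andP[ds /asboolP nD'd].
    exact/DW'/sD.
  - by rewrite mem_filter bs andbT; apply/asboolP.
move=> b bs; have [/c0->//|nD'b] := pselect (D' b).
apply: (iD [seq b <- s | ~~ `[< D' b >]]).
- exact: filter_uniq.
- by move=> d; rewrite mem_filter => /andP[/asboolP nD'd ds]; apply: sD.
- rewrite big_filter; move: Ws; rewrite big_seq_cond big1 ?add0r // => d.
  by move=> /andP[ds /asboolP/c0->]; rewrite ?scale0r.
- by rewrite mem_filter bs andbT; apply/asboolP.
Qed.

(** Finitely many vectors of the union already lie in one member of the chain. *)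
Lemma indep_mod_chain (W : P -> Prop) (I : Type) (J : I -> Prop)
    (D : I -> P -> Prop) :
    (forall i j, J i -> J j -> (forall b, D i b -> D j b) \/ (forall b, D j b -> D i b)) ->
    (forall i, J i -> indep_mod W (D i)) ->
  indep_mod W (fun b => exists2 i, J i & D i b).
Proof.
move=> chain iD [//|b0 s] c us sD Ws.
suff [i Ji Di] : exists2 i, J i & forall b, b \in b0 :: s -> D i b.
  exact: (iD i Ji _ _ us Di Ws).
elim: s {us Ws} sD => [|b s IH] sD.
  have [i Ji Di] := sD b0 (mem_head _ _).
  by exists i => // b; rewrite inE => /eqP->.
have [|i Ji Di] := IH.
  by move=> d; rewrite inE => /orP[db|ds]; apply: sD; rewrite !inE ?db ?ds ?orbT.
have [|j Jj Dj] := sD b; first by rewrite !inE eqxx orbT.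
have [ij|ji] := chain _ _ Ji Jj; [exists j | exists i] => // d;
  rewrite !inE => /or3P[db0|/eqP->|ds] //; try (by apply: ji);
  try apply: ij; apply: Di; rewrite inE ?db0 ?ds ?orbT //.
Qed.
End Span.

(** * Biorthogonal systems over a local ring *)

Section Biorthogonal.
Variables (R : comPzRingType) (P : lmodType R).
Hypothesis locR : local_ring R.
Variables (V : P -> Prop) (W : {linear P -> R^o} -> Prop).
Hypothesis V_closed : span_closed V.
Hypothesis W_closed : forall n (c : 'I_n -> R) (f : 'I_n -> {linear P -> R^o}),
  (forall i, W (f i)) ->
  exists2 g : {linear P -> R^o}, W g & forall p, g p = \sum_i c i * f i p.

(* For an expansion of [q] of least length the coefficients [phi i q] are
   irredundant, so the matrix of the [phi i (x j)] is the identity modulo the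
   maximal ideal. *)
Lemma biorthogonal_expansion q n (x : 'I_n -> P) (phi : 'I_n -> {linear P -> R^o}) :
    (forall i, V (x i)) -> (forall i, W (phi i)) ->
    q = \sum_i (phi i q : R) *: x i ->
  exists m (y : 'I_m -> P) (psi : 'I_m -> {linear P -> R^o}),
    [/\ forall i, V (y i), forall i, W (psi i),
        forall i j, psi i (y j) = (i == j)%:R
      & q = \sum_i (psi i q : R) *: y i].
Proof.
elim: n x phi => [|n IH] x phi Vx Wphi qE.
  by exists 0, x, phi; split=> // -[].
have [[i [b iE]]|irr] := pselect (exists i (b : 'I_n -> R),
    phi i q = \sum_j b j * phi (lift i j) q :> R).
  (* A redundant coefficient lets [x i] be absorbed into the other vectors, which shortens the
     expansion. *)
  apply: (IH (fun j => b j *: x i + x (lift i j)) (fun j => phi (lift i j))) => //.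
    by move=> j; apply: V_closed.2.
  rewrite {1}qE (bigD1_ord i) //= {1}iE scaler_suml -big_split /=.
  by apply: eq_bigr => j _; rewrite scalerDr scalerA mulrC.
pose C := \matrix_(i, j) (phi i (x j) : R).
have [u uC] : invertible (\det C).
  rewrite -[C](subKr 1%:M); apply: invertible_det_1B => // i j [u uD].
  (* Applying [phi i] to the expansion of [q] gives [sum_k (1 - C) i k * phi k q = 0]; a unit entry
     at [j] would express [phi j q] by the other coefficients. *)
  apply: irr; exists j, (fun k => - u * (1%:M - C) i (lift j k)).
  have : u * \sum_k (1%:M - C) i k * phi k q = 0.
    have -> : \sum_k (1%:M - C) i k * phi k q =
        \sum_k (i == k)%:R * (phi k q : R) - \sum_k (phi k q : R) * phi i (x k).
      rewrite -sumrB; apply: eq_bigr => k _.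
      by rewrite !mxE mulrBl [phi i _ * _]mulrC.
    rewrite (bigD1 i) //= eqxx mul1r big1 ?addr0; last first.
      by move=> k ki; rewrite eq_sym (negPf ki) mul0r.
    have -> : phi i q = \sum_k (phi k q : R) * phi i (x k).
      by rewrite {1}qE linear_sum; apply: eq_bigr => k _; rewrite linearZ.
    by rewrite subrr mulr0.
  rewrite (bigD1_ord j) //= mulrDr mulrA uD mul1r => /eqP.
  rewrite addr_eq0 => /eqP->; rewrite mulr_sumr -sumrN.
  by apply: eq_bigr => k _; rewrite mulrA mulNr mulNr.
(* The dual functionals are C^-1 applied to the [phi k], where C^-1 is [u] times the adjugate. *)
have /choice[psi psiE] : forall i, exists g : {linear P -> R^o}, W g /\
    forall p, g p = \sum_k (u * (\adj C) i k) * phi k p.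
  by move=> i; have [g] := W_closed (fun k => u * (\adj C) i k) Wphi; exists g.
have dual i j : psi i (x j) = (i == j)%:R.
  have [_ ->] := psiE i.
  have := congr1 (fun A : 'M[R]_n.+1 => u * A i j) (mul_adj_mx C).
  rewrite !mxE mulrnAr uC mulr_sumr => <-.
  by apply: eq_bigr => k _; rewrite [C k j]mxE mulrA.
exists n.+1, x, psi; split=> // [i|]; first by case: (psiE i).
rewrite {1}qE; apply: eq_bigr => i _; congr (_ *: _).
rewrite [in RHS]qE linear_sum (bigD1 i) //= linearZ /= dual eqxx big1 ?addr0.
  exact/esym/mulr1.
by move=> j ji; rewrite linearZ /= dual eq_sym (negPf ji) scaler0.
Qed.
End Biorthogonal.

(** * Coordinates on a free module *)

Section FreeCoordinates.
Variables (R : pzRingType) (X : choiceType).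

Definition free_coef (k : X) : {linear freemod R X -> R^o} :=
  free_lift (fun j => (j == k)%:R : R^o).

Lemma free_coef_cls k x : free_coef k (free_cls x) = fcoef x k.
Proof.
rewrite [LHS]free_lift_cls /free_sum /fcoef [RHS]big_mkcond /=.
by apply: eq_bigr => r _; case: ifP => _; [apply: mulr1 | apply: mulr0].
Qed.

Lemma free_expand (q : freemod R X) : exists s : seq X,
  (forall k, k \in s -> free_coef k q <> 0) /\
  q = \sum_(k <- s) (free_coef k q : R) *: free_gen R k.
Proof.
elim/free_ind: q => x; pose s := undup [seq p.2 | p <- x].
exists [seq k <- s | free_coef k (free_cls x) != 0]; split=> [k|].
  by rewrite mem_filter => /andP[/eqP].
have xE : free_cls x = free_sum (@free_gen R X) x.
  rewrite -free_lift_cls.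
  apply: (free_linear_ext (f := linear_of (f := @id (freemod R X)) (fun _ _ _ => erefl))).
  by move=> k /=; rewrite free_lift_gen.
rewrite {1}xE (@free_sumE _ _ _ _ s) ?undup_uniq //; last first.
  by move=> k; rewrite mem_undup.
rewrite big_filter [RHS]big_mkcond; apply: eq_bigr => k _; rewrite free_coef_cls.
by case: eqVneq => // ->; rewrite scale0r.
Qed.
End FreeCoordinates.

(** * Summands cut out by stable index sets *)

Section Kaplansky.
Variables (R : comPzRingType) (P : lmodType R) (X : choiceType).
Hypothesis locR : local_ring R.
Variables (g : {linear freemod R X -> P}) (h : {linear P -> freemod R X}).
Hypothesis hK : forall p, g (h p) = p.

Let x (k : X) : P := g (free_gen R k).
Let phi (k : X) : {linear P -> R^o} := free_coef R k \o h.

Lemma coord_expand p : exists s : seq X,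
  (forall k, k \in s -> phi k p <> 0) /\ p = \sum_(k <- s) (phi k p : R) *: x k.
Proof.
have [s [s0 sE]] := free_expand (h p); exists s; split=> //.
by rewrite -{1}(hK p) sE linear_sum; apply: eq_bigr => k _; rewrite linearZ.
Qed.

Definition supported (S : X -> Prop) (p : P) : Prop := forall k, ~ S k -> phi k p = 0.
(** For stable [S] the vectors supported in [S] are exactly the span of the [x k] with [k] in [S],
    and [proj S] retracts [P] onto it. *)
Definition stable (S : X -> Prop) : Prop := forall k, S k -> supported S (x k).

Lemma supported_closed S : span_closed (supported S).
Proof.
split=> [k _|a u v Su Sv k Sk]; first by rewrite linear0.
by rewrite linearP Su // Sv // scaler0 addr0.
Qed.

Lemma supported_sub (S S' : X -> Prop) p :
  (forall k, S k -> S' k) -> supported S p -> supported S' p.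
Proof. by move=> SS' Sp k nS'k; apply: Sp => /SS'. Qed.

Lemma supported_expand S p V : span_closed V -> (forall k, S k -> V (x k)) ->
  supported S p -> V p.
Proof.
move=> clV SV Sp; have [s [s0 ->]] := coord_expand p.
rewrite big_seq; apply: span_closed_sum => // k /s0 pk.
by apply: SV; apply: contrapT => /Sp.
Qed.

Definition proj (S : X -> Prop) : {linear P -> P} :=
  g \o free_lift (fun k => if `[< S k >] then free_gen R k else 0) \o h.

Lemma proj_expand S p (s : seq X) :
  h p = \sum_(k <- s) (phi k p : R) *: free_gen R k ->
  proj S p = \sum_(k <- s) (phi k p : R) *: (if `[< S k >] then x k else 0).
Proof.
move=> sE; pose f := fun k => if `[< S k >] then free_gen R k else 0.
pose l : {linear freemod R X -> freemod R X} := free_lift f.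
have lE k : l (free_gen R k) = f k by exact: free_lift_gen.
have -> : proj S p = g (l (h p)) by [].
move: l lE => l lE; rewrite [in LHS]sE !linear_sum; apply: eq_bigr => k _.
rewrite !linearZ lE /f; congr (_ *: _).
by case: ifP => // _; rewrite linear0.
Qed.

Lemma proj_id S p : supported S p -> proj S p = p.
Proof.
move=> Sp; have [s [s0 sE]] := free_expand (h p).
rewrite (proj_expand S sE) -[RHS]hK [in RHS]sE linear_sum big_seq [RHS]big_seq.
apply: eq_bigr => k /s0 pk; rewrite linearZ asboolT //.
by apply: contrapT => /Sp.
Qed.

Lemma proj_supported S p : stable S -> supported S (proj S p).
Proof.
move=> stS; have [s [_ /(proj_expand S)->]] := free_expand (h p).
apply: span_closed_sum => [|k _]; first exact: supported_closed.
by case: asboolP => [/stS//|_]; apply: (supported_closed S).1.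
Qed.

(** * Extending a basis from [S] to a larger stable set *)

Section Extension.
Variables (S S' : X -> Prop).
Hypothesis SS' : forall k, S k -> S' k.
Hypotheses (stS : stable S) (stS' : stable S').

(* [D] is a basis modulo [supported S] of the range of the idempotent [E]. *)
Record partial_basis (E : {linear P -> P}) (D : P -> Prop) : Prop := PartialBasis {
  pb_idem : forall p, E (E p) = E p;
  pb_supp : forall p, supported S p -> E p = p;
  pb_fix : forall d, D d -> E d = d;
  pb_sub : forall d, D d -> supported S' d;
  pb_indep : indep_mod (supported S) D;
  pb_range : forall p, lspan (fun q => supported S q \/ D q) (E p) }.

Lemma partial_basis0 : partial_basis (proj S) (fun=> False).
Proof.
have pS p := @proj_supported S p stS.
split=> //; first by move=> p; apply: proj_id.
- by move=> p; apply: proj_id.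
- by case=> [//|b s] c _ sD _; case: (sD b (mem_head _ _)).
by move=> p; apply: mem_lspan; left.
Qed.

(** The part [q'] of [q] in the kernel of [E] is expanded in a biorthogonal system [y], [psi], with
    [y] in that kernel and [psi] zero on the range of [E]; adding [sum psi i p *: y i] to [E p]
    gives a larger idempotent fixing [q]. *)
Lemma partial_basis_step E D q : partial_basis E D -> supported S' q ->
  exists E' D', [/\ partial_basis E' D', forall d, D d -> D' d, E' q = q
    & forall p, E p = p -> E' p = p].
Proof.
move=> pb S'q; pose q' := q - E q.
have S'closed := supported_closed S'.
have S'E p : supported S' (E p).
  apply: (lspan_min S'closed _ (pb_range pb p)) => d [|/(pb_sub pb)//].
  exact: supported_sub.
have S'q' : supported S' q' := span_closedB S'closed S'q (S'E q).
have Eq' : E q' = 0 by rewrite linearB /= (pb_idem pb) subrr.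
pose V p := supported S' p /\ E p = 0.
pose W (f : {linear P -> R^o}) := forall p, f (E p) = 0.
have clV : span_closed V.
  split=> [|a u v [Su Eu] [Sv Ev]].
    by split; [exact: S'closed.1 | rewrite linear0].
  by split; [exact: S'closed.2 | rewrite linearP /= Eu Ev scaler0 addr0].
have clW n (c : 'I_n -> R) (f : 'I_n -> {linear P -> R^o}) : (forall i, W (f i)) ->
    exists2 f' : {linear P -> R^o}, W f' & forall p, f' p = \sum_i c i * f i p.
  move=> Wf; have lin : linear (fun p => (\sum_i c i * f i p : R^o)).
    move=> a u v; rewrite scaler_sumr -big_split; apply: eq_bigr => i _ /=.
    by rewrite linearP mulrDr; congr (_ + _); apply: mulrCA.
  exists (linear_of lin) => // p /=; apply: big1 => i _.
  by rewrite Wf mulr0.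
have [s [s0 sE]] := coord_expand q'.
(* The complementary projection [tau] fixes [q']; it moves the vectors of its expansion into [V] and
   the coordinates into [W]. *)
have tau_lin : linear (fun p => p - E p).
  by move=> a u v; rewrite (linearP E) scalerBr opprD addrACA.
pose tau := linear_of tau_lin.
have Etau p : E (tau p) = 0 by rewrite linearB /= (pb_idem pb) subrr.
have tauE p : tau (E p) = 0 by rewrite /= (pb_idem pb) subrr.
have tauq' : tau q' = q' by rewrite /= Eq' subr0.
pose k i := tnth (in_tuple s) i.
have [|||m [y [psi [Vy Wpsi dual q'E]]]] := @biorthogonal_expansion R P locR V W
  clV clW q' (size s) (fun i => tau (x (k i))) (fun i => phi (k i) \o tau).
- move=> i; split; last exact: Etau.
  (* Indices in [s] have nonzero coordinate in [q'], so they lie in [S']. *)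
  apply: (span_closedB S'closed) => //; apply: stS'; apply: contrapT => /S'q'.
  exact/s0/mem_tnth.
- by move=> i p; apply: etrans (congr1 (phi (k i)) (tauE p)) (linear0 _).
- rewrite -{1}tauq' {1}sE big_tnth linear_sum; apply: eq_bigr => i _.
  by rewrite linearZ; congr (_ *: _); apply: (congr1 (phi _) (esym tauq')).
have E'lin : linear (fun p => E p + \sum_i (psi i p : R) *: y i).
  move=> a u v; rewrite linearP scalerDr addrACA scaler_sumr -big_split.
  congr (_ + _); apply: eq_bigr => i _.
  by rewrite linearP /= scalerDl scalerA.
pose E' := linear_of E'lin.
have E'E p : E p = p -> E' p = p.
  move=> pE; rewrite /= {1}pE big1 ?addr0 // => i _.
  by rewrite -pE Wpsi scale0r.
have E'y i : E' (y i) = y i.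
  rewrite /= (Vy i).2 add0r (bigD1 i) //= dual eqxx scale1r big1 ?addr0 // => j ji.
  by rewrite dual (negPf ji) scale0r.
exists E', (fun d => D d \/ exists i, d = y i); split=> //; first last.
- rewrite -[in LHS](subrK (E q) q) -/q' (linearD E') (E'E (E q)) ?(pb_idem pb) //.
  by rewrite (_ : E' q' = q') ?subrK //= Eq' add0r -q'E.
- by move=> d; left.
split.
- move=> p; rewrite {2}/E' [linear_of _ p]/= (linearD E') (E'E (E p)) ?(pb_idem pb) //.
  rewrite linear_sum; congr (_ + _); apply: eq_bigr => i _.
  by rewrite linearZ; congr (_ *: _); apply: E'y.
- by move=> p /(pb_supp pb)/E'E.
- by move=> d [/(pb_fix pb)/E'E|[i ->]].
- by move=> d [/(pb_sub pb)|[i ->]] //; exact: (Vy i).1.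
(* The [y i] are independent modulo the range of [E]: [psi i] kills that range and reads off the
   coefficient of [y i]. *)
- apply: (@indep_modU _ _ (supported S) (fun p => E p = p)) (pb_indep pb) _.
  + split=> [|a u v Eu Ev]; first exact: linear0.
    by rewrite linearP /= Eu Ev.
  + exact: (pb_supp pb).
  + exact: (pb_fix pb).
  move=> l c ul lD lE b bl; have [i bi] := lD b bl.
  have : psi i (\sum_(d <- l) c d *: d) = 0 by rewrite -lE Wpsi.
  have psib : psi i b = 1 by rewrite bi dual eqxx.
  rewrite linear_sum (bigD1_seq b) //= linearZ psib big_seq_cond big1.
    by rewrite addr0 => <-; apply/esym/mulr1.
  move=> d /andP[dl db]; have [j dj] := lD d dl.
  have psid : psi i d = 0.
    by rewrite dj dual; case: eqVneq => // ij; rewrite dj -ij -bi eqxx in db.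
  by rewrite linearZ psid; apply: mulr0.
move=> p /=; apply: (span_closedD (lspan_closed _)).
  apply: (lspan_min (lspan_closed _) _ (pb_range pb p)) => d Dd.
  by apply: mem_lspan; case: Dd; [left | right; left].
apply: (span_closed_sum _ _ (lspan_closed _)) => i _.
by apply: mem_lspan; right; right; exists i.
Qed.

Lemma partial_basis_steps E D (s : seq X) : partial_basis E D ->
    (forall k, k \in s -> S' k) ->
  exists E' D', [/\ partial_basis E' D', forall d, D d -> D' d
    & forall k, k \in s -> E' (x k) = x k].
Proof.
elim: s E D => [|k s IH] E D pb sS'; first by exists E, D.
have [|E1 [D1 [pb1 D1s E1s]]] := IH _ _ pb.
  by move=> j js; apply: sS'; rewrite inE js orbT.
have [|E2 [D2 [pb2 D12 E2k E12]]] := partial_basis_step (q := x k) pb1.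
  exact/stS'/sS'/mem_head.
exists E2, D2; split=> // [d /D1s/D12//|j]; rewrite inE => /orP[/eqP->//|].
by move/E1s/E12.
Qed.

(** Stage n+1 makes the idempotent fix [x k] for [k] in [T n], so these vectors enter the span of
    [D n.+1] and the vectors supported in [S]. The [D n] increase, and their union remains
    independent. *)
Lemma countable_extension (T : nat -> seq X) :
    (forall n k, k \in T n -> S' k) ->
    (forall k, S' k -> S k \/ exists n, k \in T n) ->
  exists D : P -> Prop, [/\ forall d, D d -> supported S' d,
    indep_mod (supported S) D
    & forall p, supported S' p -> lspan (fun q => supported S q \/ D q) p].
Proof.
move=> TS' S'T.
pose state := {ED : {linear P -> P} * (P -> Prop) | partial_basis ED.1 ED.2}.
have /choice[next nextP] : forall u : nat * state, exists v : state,
    (forall d, (sval u.2).2 d -> (sval v).2 d) /\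
    (forall k, k \in T u.1 -> (sval v).1 (x k) = x k).
  move=> [n [[E D] pb]] /=.
  have [E' [D' [pb' DD' E'x]]] := partial_basis_steps pb (@TS' n).
  by exists (exist _ (E', D') pb').
pose st := fix st n : state := if n is m.+1 then next (m, st m)
  else exist _ (proj S, fun=> False) partial_basis0.
pose D n := (sval (st n)).2.
have pbD n : partial_basis (sval (st n)).1 (D n) := proj2_sig (st n).
have Dmono m n d : (m <= n)%N -> D m d -> D n d.
  elim: n => [|n IH]; first by rewrite leqn0 => /eqP->.
  rewrite leq_eqVlt => /orP[/eqP->//|mn] Dmd.
  exact/(nextP (n, st n)).1/IH.
exists (fun d => exists2 n, True & D n d); split.
- by move=> d [n _ /(pb_sub (pbD n))].
- apply: indep_mod_chain => [m n _ _|n _]; last exact: pb_indep (pbD n).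
  by case/orP: (leq_total m n) => le_mn; [left | right] => d; apply: Dmono.
move=> p; apply: supported_expand => [|k /S'T[Sk|[n kTn]]].
- exact: lspan_closed.
- by apply: mem_lspan; left; apply: stS.
rewrite -((nextP (n, st n)).2 k kTn).
apply: (lspan_min (lspan_closed _) _ (pb_range (pbD n.+1) (x k))) => d [Sd|Dd].
  by apply: mem_lspan; left.
by apply: mem_lspan; right; exists n.+1.
Qed.
End Extension.

(** * Countable stable closures and the maximality argument *)

Lemma coord_finite p : exists s : seq X, forall k, k \notin s -> phi k p = 0.
Proof.
have [s [_ sE]] := free_expand (h p); exists s => k ks.
rewrite /phi [LHS]/= -[free_lift _ _]/(free_coef R k (h p)) sE linear_sum big_seq.
apply: big1 => j js; have jk : free_coef R k (free_gen R j) = 0.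
  rewrite [LHS]free_lift_gen (_ : j == k = false) //.
  by apply: contraNF ks => /eqP<-.
by rewrite linearZ jk; apply: mulr0.
Qed.

(** Each [x k] has finitely many nonzero coordinates; iterating these supports from [k0] gives
    finite lists [T n], whose union with [S] is stable. *)
Lemma stable_extension S k0 : stable S ->
  exists (S' : X -> Prop) (D : P -> Prop), [/\ stable S', forall k, S k -> S' k, S' k0,
    forall d, D d -> supported S' d & indep_mod (supported S) D /\
    forall p, supported S' p -> lspan (fun q => supported S q \/ D q) p].
Proof.
move=> stS; have /choice[supp suppP] := fun k => coord_finite (x k).
pose T n := iter n (fun s => flatten (map supp s)) [:: k0].
pose S' k := S k \/ exists n, k \in T n.
have SS' k : S k -> S' k by left.
have stS' : stable S'.
  move=> k [Sk|[n kn]]; first exact/(supported_sub SS')/stS.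
  move=> j nS'j; apply: suppP; apply/negP => js; apply: nS'j.
  right; exists n.+1; apply/flatten_mapP; by exists k.
have [|//|D [DS' iD sD]] := countable_extension SS' stS stS' (T := T).
  by move=> n k kn; right; exists n.
by exists S', D; split=> //; right; exists 0; apply: mem_head.
Qed.

Lemma kaplansky_basis : exists B : P -> Prop, is_basis B.
Proof.
(* [Zorn_bigcup] is stated for sets, so a pair (S, B) is encoded as a subset of
   [X + P]. *)
pose St (A : set (X + P)) (k : X) : Prop := A (inl k).
pose Ba (A : set (X + P)) (b : P) : Prop := A (inr b).
pose good (A : set (X + P)) : Prop := [/\ stable (St A),
  forall b, Ba A b -> supported (St A) b, indep_mod (eq^~ 0) (Ba A)
  & forall k, St A k -> lspan (Ba A) (x k)].
have [F Fgood Ftot|A [[stA BA iA sA] Amax]] := @Zorn_bigcup _ good.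
  have FS A k : F A -> St A k -> St (\bigcup_(A in F) A)%classic k.
    by move=> FA Ak; exists A.
  split.
  - move=> k [A FA Ak]; apply: (supported_sub (S := St A)); first by move=> j; apply: FS.
    by have [stA _ _ _] := Fgood A FA; apply: stA.
  - move=> b [A FA Ab]; apply: (supported_sub (S := St A)); first by move=> j; apply: FS.
    by have [_ BA _ _] := Fgood A FA; apply: BA.
  - apply: (@indep_mod_chain _ _ (eq^~ 0) _ F Ba) => [A A' FA FA'|A /Fgood[]//].
    by have [sub|sub] := Ftot _ _ FA FA'; [left | right] => b; apply: sub.
  - move=> k [A FA Ak]; have [_ _ _ sA] := Fgood A FA.
    apply: (lspan_min (lspan_closed _) _ (sA k Ak)) => b Ab.
    by apply: mem_lspan; exists A.
(* An index missing from a maximal pair would give a good pair strictly containing it. *)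
have allA k0 : St A k0.
  apply: contrapT => nk0.
  have [S' [D [stS' SS' S'k0 DS' [iD sD]]]] := stable_extension k0 stA.
  pose A' : set (X + P) := fun z => match z with inl k => S' k | inr b => Ba A b \/ D b end.
  apply: (Amax A').
    split; first by move=> [k /SS'|b Ab] //; left.
    by move=> /(_ (inl k0) S'k0).
  split=> //.
  - by move=> b [/BA|/DS'] //; apply: supported_sub.
  - apply: (indep_modU (supported_closed (St A))) iA iD => // p ->.
    exact: (supported_closed _).1.
  - move=> k /stS' Sxk; apply: (lspan_min (lspan_closed _) _ (sD _ Sxk)) => d [Ad|Dd].
      apply: (supported_expand (lspan_closed _) _ Ad) => j /sA.
      by move/(lspan_min (lspan_closed _)); apply=> b Ab; apply: mem_lspan; left.
    by apply: mem_lspan; right.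
exists (Ba A); split=> [s c us sB s0|p]; first exact: (iA s c us sB s0).
apply: lspanP; apply: (supported_expand (S := St A) (lspan_closed _)) => //.
Qed.
End Kaplansky.

Lemma local_projective_free (R : comPzRingType) (P : lmodType R) :
  local_ring R -> projective_module P -> free_module P.
Proof.
move=> locR projP.
have [|h hK] := projective_lift (g := free_cover P)
    (f := linear_of (f := @id P) (fun _ _ _ => erefl)) projP.
  exact: free_cover_surj.
exact: (kaplansky_basis locR hK).
Qed.

(** A fraction is a unit exactly when its numerator avoids [p], and two numerators in [p] give a sum
    with numerator in [p]. *)
Lemma ring_at_prime_local (R : comNzRingType) (p : prime_idealr R) :
  local_ring (ring_at_prime p).
Proof.
have unitP a s : invertible (rfrac a s : ring_at_prime p) <-> a \notin p.
  split=> [[u]|ap].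
    elim/locring_ind: u => b t; rewrite [_ * _]rfracM => /fracP[v vp] /=.
    rewrite scale1r [_ *: 1]mulr1 => e; apply/negP => ap.
    have : v * (sval t * sval s) \in p.
      have -> : v * (sval t * sval s) = v * (b * a).
        by apply/esym/eqP; rewrite -subr_eq0 -mulrBr; apply/eqP.
      by rewrite !prime_idealrM ap !orbT.
    rewrite !prime_idealrM; move: vp (valP t) (valP s).
    by rewrite /prime_compl !unfold_in => /negPf-> /negPf-> /negPf->.
  pose s' : {s : R | s \in @prime_compl R p} := exist _ a ap.
  exists (rfrac (sval s) s'); rewrite [LHS]rfracM.
  apply/fracP; exists 1; first exact: rpred1.
  by rewrite /= !scale1r [X in _ - X]mulr1 mulrC subrr.
split=> [|a b].
  have -> : (0 : ring_at_prime p) = rfrac 0 (denom1 _) by [].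
  by move/unitP; rewrite idealr0.
elim/locring_ind: a => a s; elim/locring_ind: b => b t.
rewrite [_ + _]rfracD !unitP => ab.
apply: contrapT => /not_orP[/negP/negPn ap /negP/negPn bp].
by case/negP: ab; rewrite rpredD // idealMr.
Qed.

Theorem proposition2p10 (R : comNzRingType) (M : lmodType R)
    (hM : tau_q_projective M) :
  @projective_module (total_quotient_ring {poly R}) (tensor (to_TRx R) M)
  /\ (forall p : prime_idealr R, ~ semiregular p ->
        @free_module (ring_at_prime p) (mod_at_prime p M)).
Proof.
split=> [|p np]; first exact: tau_q_projective_TRx.
exact: local_projective_free (@ring_at_prime_local R p)
  (tau_q_projective_at_prime hM np).
Qed.
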